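(* Let $p\in(1,\infty]$. The class $\mathsf{Sep}\cap\mathsf{A}_p$ of separable Banach spaces belonging to $\mathsf{A}_p$ and the class $\mathsf{Sep}\cap\mathsf{N}_p$ of separable Banach spaces belonging to $\mathsf{N}_p$ are Borel; that is, the set of all $F\in\mathsf{SB}$ that belong to $\mathsf{A}_p$ is a Borel subset of $\mathsf{SB}$, and the set of all $F\in\mathsf{SB}$ that belong to $\mathsf{N}_p$ is a Borel subset of $\mathsf{SB}$.
   Context: Banach spaces are over $\mathbb K\in\{\mathbb R,\mathbb C\}$; $B_X$ is the closed unit ball of $X$. Games. Let $1<p\le\infty$, let $X$ be a Banach space, $n\in\mathbb N$, $c>0$. In the $A(c,p,n)$ game on $X$, for $i=1,\dots,n$ in turn, Player I chooses a weakly open neighborhood $U_i$ of $0$ in $X$ and then Player II chooses $x_i\in U_i\cap B_X$. Player I wins if $\|\sum_{i=1}^n a_ix_i\|\le c$ for all scalars $(a_i)_{i=1}^n$ in the closed unit ball of $\ell_p^n$; otherwise Player II wins. The $N(c,p,n)$ game is the same except that Player I wins if and only if $\|\sum_{i=1}^n x_i\|\le c\,n^{1/p}$ (with $n^{1/\infty}=1$). A winning strategy for Player I is a function $\chi$ assigning to each sequence of length $<n$ (including the empty one) in $B_X$ a weakly open neighborhood of $0$, such that every $(x_i)_{i=1}^n$ in $B_X$ with $x_j\in\chi((x_i)_{i=1}^{j-1})$ for all $1\le j\le n$ satisfies Player I's winning condition. Let $\mathsf a_{p,n}(X)$ (resp. $\mathsf n_{p,n}(X)$) be the infimum of those $c>0$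 such that Player I has a winning strategy in the $A(c,p,n)$ (resp. $N(c,p,n)$) game, and $\mathsf a_p(X)=\sup_n\mathsf a_{p,n}(X)$, $\mathsf n_p(X)=\sup_n\mathsf n_{p,n}(X)$. $\mathsf A_p$ is the class of Banach spaces $X$ with $\mathsf a_p(X)<\infty$ and $\mathsf N_p$ the class of those with $\mathsf n_p(X)<\infty$. Both are invariant under linear isomorphism. Coding. Let $C(\Delta)$ be the space of continuous scalar functions on the Cantor space $\Delta=\{0,1\}^{\mathbb N}$ with the sup norm (it contains an isometric copy of every separable Banach space). The set $\mathcal F(C(\Delta))$ of closed subsets of $C(\Delta)$ carries the Effros-Borel $\sigma$-algebra, generated by the sets $\{F:F\cap U\neq\emptyset\}$, $U$ open. $\mathsf{SB}$ is the set of $F\in\mathcal F(C(\Delta))$ that are linear subspaces of $C(\Delta)$, with the induced $\sigma$-algebra; it is a standard Borel space. An isomorphism-invariant class of separable Banach spaces is called Borel if the set of its members in $\mathsf{SB}$ is Borel in $\mathsf{SB}$. *)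

(* Defs.v *)
From HB Require Import structures.
From mathcomp Require Import all_boot all_order all_algebra.
From mathcomp Require Import complex.
From mathcomp Require Import ring.
From mathcomp Require Import all_classical all_reals all_analysis.

Set Implicit Arguments.
Unset Strict Implicit.
Unset Printing Implicit Defensive.

Import Order.TTheory GRing.Theory Num.Theory.
Import numFieldNormedType.Exports.

Local Open Scope classical_set_scope.
Local Open Scope ring_scope.

Variant scalar_kind := RealScalars | ComplexScalars.

Definition scalar_field (R : realType) (k : scalar_kind) : numFieldType :=
  match k with
  | RealScalars => R : numFieldType
  | ComplexScalars => R[i] : numFieldType
  end.

(* Norms of a [normedModType K] take their values in [K]; [re] and [of_real]
   mediate between the nonnegative elements of [K] and real numbers. *)
Definition re (R : realType) (k : scalar_kind) : scalar_field R k -> R :=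
  match k return scalar_field R k -> R with
  | RealScalars => id
  | ComplexScalars => @complex.Re R
  end.

Definition of_real (R : realType) (k : scalar_kind) : R -> scalar_field R k :=
  match k return R -> scalar_field R k with
  | RealScalars => id
  | ComplexScalars => fun r => (r%:C)%C
  end.

Section ScalarTheory.
Variables (R : realType) (k : scalar_kind).
Local Notation K := (scalar_field R k).

Lemma of_realK : cancel (@of_real R k) (@re R k).
Proof. by case: k. Qed.

Lemma reK (x : K) : 0 <= x -> of_real k (re x) = x.
Proof.
case: k x => //= -[a b]; rewrite lecE /= => /andP[/eqP -> _] //.
Qed.

Lemma ler_of_real : {mono @of_real R k : x y / x <= y}.
Proof. by case: k => //= x y; rewrite lecR. Qed.

Lemma ltr_of_real : {mono @of_real R k : x y / x < y}.
Proof. by case: k => //= x y; rewrite ltcR. Qed.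

Lemma of_realD : {morph @of_real R k : x y / x + y}.
Proof. by case: k => //= x y; rewrite rmorphD. Qed.

Lemma of_realM : {morph @of_real R k : x y / x * y}.
Proof. by case: k => //= x y; rewrite rmorphM. Qed.

Lemma of_real0 : of_real k 0 = 0 :> K.
Proof. by case: k. Qed.

Lemma of_real_inj : injective (@of_real R k).
Proof. exact: can_inj of_realK. Qed.

Lemma gt0_of_real (e : K) : 0 < e -> exists2 r : R, 0 < r & e = of_real k r.
Proof.
move=> e0; exists (re e); last by rewrite reK// ltW.
by rewrite -ltr_of_real of_real0 reK// ltW.
Qed.

Lemma scalar_complete (F : set_system K) : ProperFilter F -> cauchy F -> cvg F.
Proof.
case: k F => F FF /= cF; first exact: (@R_complete R F FF cF).
have {}cF : cauchy_ex F by apply/cauchyP.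
have norm_i : `|'i%C| = 1 :> R[i] by rewrite normc_def /= expr0n expr1n add0r sqrtr1.
have normRe (z : R[i]) : (`|complex.Re z|%:C)%C <= `|z| by exact: normc_ge_Re.
have normIm (z : R[i]) : (`|complex.Im z|%:C)%C <= `|z|.
  by have := normRe (z * 'i%C); rewrite ReiNIm normrN normrM norm_i mulr1.
have cvgp (h : R[i] -> R) :
    (forall x y, (`|h x - h y|%:C)%C <= `|x - y|) -> cvg (h @ F).
  move=> hle; apply: R_complete; apply/cauchyP => e e0.
  have e0' : 0 < (e%:C)%C :> R[i] by rewrite ltcR.
  have [x Fx] := cF _ e0'; exists (h x).
  suff sub : ball x (e%:C)%C `<=` h @^-1` ball (h x) e.
    exact: (@filterS _ F _ _ _ sub Fx).
  move=> y; rewrite -!ball_normE /= -ltcR; exact: le_lt_trans (hle x y).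
have /cvgp/cvg_ex[a /= cRe] x y :
    (`|complex.Re x - complex.Re y|%:C)%C <= `|x - y| :> R[i].
  by rewrite -raddfB; exact: normRe.
have /cvgp/cvg_ex[b /= cIm] x y :
    (`|complex.Im x - complex.Im y|%:C)%C <= `|x - y| :> R[i].
  by rewrite -raddfB; exact: normIm.
apply: (@cvgP (scalar_field R ComplexScalars) F (a +i* b)%C).
apply/(@cvgrPdist_lt (scalar_field R ComplexScalars)
  (scalar_field R ComplexScalars)^o) => e /[dup] e0.
rewrite ltcE /= => /andP[/eqP e_im e_re].
have -> : e = ((complex.Re e / 2 + complex.Re e / 2)%:C)%C.
  by rewrite -splitr; apply/eqP; rewrite eq_complex /= e_im !eqxx.
have d0 : 0 < complex.Re e / 2 by rewrite divr_gt0.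
move/cvgrPdist_lt: cRe => /(_ _ d0) cRe.
move/cvgrPdist_lt: cIm => /(_ _ d0) cIm.
near=> z.
rewrite [_ - z]complexE !raddfB /=.
apply: le_lt_trans (ler_normD _ _) _; rewrite normrM norm_i mul1r !normc_def /=.
rewrite subrr !expr0n !addr0 !sqrtr_sqr -!rmorphD /= ltcR ltrD //.
- by near: z; exact: cRe.
- by near: z; exact: cIm.
Unshelve. all: by end_near. Qed.

End ScalarTheory.

Section RealNorm.
Variables (R : realType) (k : scalar_kind) (V : normedModType (scalar_field R k)).

Definition rnorm (x : V) : R := re `|x|.

Lemma rnormE x : of_real k (rnorm x) = `|x|.
Proof. exact: reK. Qed.

Lemma rnorm_ge0 x : 0 <= rnorm x.
Proof. by rewrite -(ler_of_real k) of_real0 rnormE. Qed.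

Lemma ler_rnormD x y : rnorm (x + y) <= rnorm x + rnorm y.
Proof. by rewrite -(ler_of_real k) of_realD !rnormE ler_normD. Qed.

Lemma rnormN x : rnorm (- x) = rnorm x.
Proof. by rewrite /rnorm normrN. Qed.

Lemma rnorm_dist x y : `|rnorm x - rnorm y| <= rnorm (x - y).
Proof.
have H a b : rnorm a - rnorm b <= rnorm (a - b).
  by rewrite lerBlDr; have := ler_rnormD (a - b) b; rewrite subrK.
by rewrite ler_norml H andbT lerNl opprB -(rnormN (x - y)) opprB H.
Qed.

End RealNorm.

Definition CDelta (R : realType) (k : scalar_kind) : Type :=
  continuousType cantor_space (scalar_field R k).

Section CDelta.
Variables (R : realType) (k : scalar_kind).
Local Notation K := (scalar_field R k).
Local Notation C := (CDelta R k).

HB.instance Definition _ := Choice.on C.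

Definition cd_fun (f : C) : cantor_space -> K := f.
Definition cd_of (f : cantor_space -> K) (cf : continuous f) : C := mkcts cf.

Let addc (f g : C) : continuous (fun x => cd_fun f x + cd_fun g x).
Proof. by move=> x; apply: (@cvgD _ K^o); exact: cts_fun. Qed.
Let oppc (f : C) : continuous (fun x => - cd_fun f x).
Proof. by move=> x; apply: (@cvgN _ K^o); exact: cts_fun. Qed.
Let zeroc : continuous (fun _ : cantor_space => 0 : K).
Proof. by move=> x; exact: cvg_cst. Qed.
Let scalec (a : K) (f : C) : continuous (fun x => a * cd_fun f x).
Proof. by move=> x; apply: (@cvgZr _ K^o); exact: cts_fun. Qed.

Let CP (f g : C) : cd_fun f =1 cd_fun g -> f = g.
Proof. by move/continuousEP. Qed.

Fact cd_addA : associative (fun f g : C => cd_of (@addc f g)).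
Proof. by move=> f g h; apply: CP => x; exact: addrA. Qed.
Fact cd_addC : commutative (fun f g : C => cd_of (@addc f g)).
Proof. by move=> f g; apply: CP => x; exact: addrC. Qed.
Fact cd_add0 : left_id (cd_of zeroc) (fun f g : C => cd_of (@addc f g)).
Proof. by move=> f; apply: CP => x; exact: add0r. Qed.
Fact cd_addN : left_inverse (cd_of zeroc) (fun f : C => cd_of (@oppc f))
  (fun f g : C => cd_of (@addc f g)).
Proof. by move=> f; apply: CP => x; exact: addNr. Qed.
HB.instance Definition _ := GRing.isZmodule.Build C
  cd_addA cd_addC cd_add0 cd_addN.

Fact cd_scaleA (a b : K) (f : C) :
  cd_of (@scalec a (cd_of (@scalec b f))) = cd_of (@scalec (a * b) f).
Proof. by apply: CP => x; exact: mulrA. Qed.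
Fact cd_scale1 : left_id (1 : K) (fun a f => cd_of (@scalec a f)).
Proof. by move=> f; apply: CP => x; exact: mul1r. Qed.
Fact cd_scaleDr : right_distributive (fun a f => cd_of (@scalec a f)) +%R.
Proof. by move=> a f g; apply: CP => x; exact: mulrDr. Qed.
Fact cd_scaleDl (f : C) : {morph (fun a => cd_of (@scalec a f)) : a b / a + b}.
Proof. by move=> a b; apply: CP => x; exact: mulrDl. Qed.
HB.instance Definition _ := GRing.Zmodule_isLmodule.Build K C
  cd_scaleA cd_scale1 cd_scaleDr cd_scaleDl.

Definition cd_sup (f : C) : R := sup (range (fun x => rnorm (cd_fun f x : K^o))).

Lemma cd_has_sup (f : C) : has_sup (range (fun x => rnorm (cd_fun f x : K^o))).
Proof.
split; first by exists (rnorm (cd_fun f point : K^o)), point.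
have cn : {within [set: cantor_space],
    continuous (fun x => rnorm (cd_fun f x : K^o))}.
  apply: continuous_subspaceT => x; apply/cvgrPdist_lt => e e0.
  have e0' : 0 < of_real k e by rewrite -(of_real0 R k) ltr_of_real.
  have /(@cvgrPdist_lt _ K^o)/(_ _ e0') := @cts_fun _ _ f x.
  apply: filterS => y xy; apply: le_lt_trans (rnorm_dist _ _) _.
  by rewrite -(ltr_of_real k) rnormE.
have [c _ cmax] := @compact_EVT_max _ R _ _ (ex_intro _ point I) cantor_space_compact cn.
by exists (rnorm (cd_fun f c : K^o)) => _ [x _ <-]; exact/cmax/in_setT.
Qed.

Lemma le_cd_sup (f : C) x : rnorm (cd_fun f x : K^o) <= cd_sup f.
Proof. by apply: ub_le_sup; [exact: (cd_has_sup f).2|exists x]. Qed.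

Lemma cd_sup_le (f : C) M :
  (forall x, rnorm (cd_fun f x : K^o) <= M) -> cd_sup f <= M.
Proof. by move=> fM; apply: ge_sup; [exact: (cd_has_sup f).1|move=> _ [x _ <-]]. Qed.

Definition cd_norm (f : C) : K := of_real k (cd_sup f).

Fact cd_normD (f g : C) : cd_norm (f + g) <= cd_norm f + cd_norm g.
Proof.
rewrite /cd_norm -of_realD ler_of_real; apply: cd_sup_le => x.
by apply: le_trans (ler_rnormD _ _) _; rewrite lerD// le_cd_sup.
Qed.

Fact cd_normZ (a : K) (f : C) : cd_norm (a *: f) = `|a| * cd_norm f.
Proof.
rewrite -(rnormE (a : K^o)) /cd_norm -of_realM; congr of_real.
have rnormM (x y : K^o) : rnorm (x * y : K^o) = rnorm x * rnorm y.
  by apply: (@of_real_inj R k); rewrite of_realM !rnormE normrM.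
apply/eqP; rewrite eq_le; apply/andP; split.
  by apply: cd_sup_le => x; rewrite rnormM ler_wpM2l ?rnorm_ge0// le_cd_sup.
have [->|a0] := eqVneq (rnorm (a : K^o)) 0.
  by rewrite mul0r (le_trans _ (le_cd_sup _ point))// rnorm_ge0.
have a_gt0 : 0 < rnorm (a : K^o) by rewrite lt_neqAle eq_sym a0 rnorm_ge0.
rewrite mulrC -ler_pdivlMr//; apply: cd_sup_le => x.
by rewrite ler_pdivlMr// mulrC -rnormM; exact: le_cd_sup (a *: f) x.
Qed.

Fact cd_norm0_eq0 (f : C) : cd_norm f = 0 -> f = 0.
Proof.
rewrite /cd_norm -(of_real0 R k) => /of_real_inj f0; apply: CP => x.
apply/eqP; rewrite -(@normr_eq0 _ K^o) -rnormE -(of_real0 R k).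
by apply/eqP; congr of_real; apply/eqP; rewrite eq_le rnorm_ge0 andbT -f0 le_cd_sup.
Qed.

HB.instance Definition _ := Lmodule_isNormed.Build K C
  cd_normD cd_normZ cd_norm0_eq0.

Lemma cd_norm_lt (f : C) (e : K) x : `|f| < e -> `|cd_fun f x| < e.
Proof.
apply: le_lt_trans; rewrite -(rnormE (cd_fun f x : K^o)).
by rewrite ler_of_real le_cd_sup.
Qed.

Lemma cd_norm_le (f : C) (e : K) : (forall x, `|cd_fun f x| <= e) -> `|f| <= e.
Proof.
move=> fe; have e0 : 0 <= e := le_trans (normr_ge0 _) (fe point).
rewrite -(reK e0) ler_of_real; apply: cd_sup_le => x.
by rewrite -(ler_of_real k) reK// rnormE.
Qed.

Lemma CDelta_complete (F : set_system C) : ProperFilter F -> cauchy F -> cvg F.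
Proof.
move=> FF /cauchyP cF.
have evc x : cvg ((fun f : C => cd_fun f x) @ F).
  apply: scalar_complete; apply/cauchyP => e e0.
  have [f Ff] := cF e e0; exists (cd_fun f x).
  suff sub : ball f e `<=` (fun f : C => cd_fun f x) @^-1` ball (cd_fun f x) e.
    exact: (@filterS _ F _ _ _ sub Ff).
  by move=> g; rewrite -!ball_normE /=; exact: (@cd_norm_lt (f - g)).
pose g x : K := lim ((fun f : C => cd_fun f x) @ F).
have unif (e : K) : 0 < e ->
    \forall f \near F, forall x, `|g x - cd_fun f x| <= e.
  move=> e0; have e20 : 0 < e / 2 by rewrite divr_gt0.
  have [f0 + ] := cF _ e20; rewrite -ball_normE => Ff0.
  near=> f => x.
  rewrite (splitr e) -(subrK (cd_fun f0 x) (g x)) -addrA.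
  apply: le_trans (ler_normD _ _) _; apply: lerD; last first.
    apply/ltW/(@cd_norm_lt (f0 - f)).
    by near: f; exact: Ff0.
  apply/ler_addgt0Pr => d d0.
  near F => f1.
  rewrite -(subrK (cd_fun f1 x) (g x)) -addrA addrC.
  apply: le_trans (ler_normD _ _) _; apply: lerD; apply/ltW.
    rewrite distrC; apply: (@cd_norm_lt (f0 - f1)).
    by near: f1; exact: Ff0.
  near: f1.
  by move/(@cvgrPdist_lt _ K^o): (evc x) => /(_ _ d0).
have gc : continuous g.
  move=> x; apply/(@cvgrPdist_lt _ K^o) => e e0.
  have e30 : 0 < e / 3%:R by rewrite divr_gt0.
  have [f gf] := filter_ex (unif _ e30).
  have /(@cvgrPdist_lt _ K^o)/(_ _ e30) := @cts_fun _ _ f x.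
  apply: filterS => y xy.
  have -> : g x - g y = (g x - cd_fun f x) + (cd_fun f y - g y)
      + (cd_fun f x - cd_fun f y) by rewrite addrACA addrC; ring.
  have -> : e = e / 3%:R + e / 3%:R + e / 3%:R by field.
  apply: le_lt_trans (ler_normD _ _) _; apply: ler_ltD => //.
  apply: le_trans (ler_normD _ _) _; apply: lerD => //.
  by rewrite distrC.
apply: (@cvgP _ _ (cd_of gc)); apply/cvgrPdist_le => e e0.
by apply: filterS (unif e e0) => f gf; exact: cd_norm_le.
Unshelve. all: by end_near. Qed.

HB.instance Definition _ := Uniform_isComplete.Build C CDelta_complete.

End CDelta.

Definition closed_set (T : topologicalType) : Type := {F : set T | closed F}.

Definition closed_subspace (K : numFieldType) (V : normedModType K) : Type :=
  {F : closed_set V | submod_closed (mem (sval F))}.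

Definition carrier (K : numFieldType) (V : normedModType K)
  (F : closed_subspace V) : Type := {x : V | x \in sval (sval F)}.

Section Carrier.
Variables (K : numFieldType) (V : completeNormedModType K).
Variable F : closed_subspace V.
Local Notation X := (carrier F).

Fact carrier_submod : subsemimod_closed (mem (sval (sval F))).
Proof. exact: GRing.submod_closed_semi (svalP F). Qed.

HB.instance Definition _ := SubChoice.on X.
HB.instance Definition _ :=
  GRing.SubChoice_isSubLmodule.Build K V (mem (sval (sval F))) X carrier_submod.

Definition carrier_norm (x : X) : K := `|val x|.

Fact carrier_normD (x y : X) :
  carrier_norm (x + y) <= carrier_norm x + carrier_norm y.
Proof. by rewrite /carrier_norm raddfD ler_normD. Qed.
Fact carrier_normZ (a : K) (x : X) :
  carrier_norm (a *: x) = `|a| * carrier_norm x.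
Proof. by rewrite /carrier_norm linearZ normrZ. Qed.
Fact carrier_norm0_eq0 (x : X) : carrier_norm x = 0 -> x = 0.
Proof. by move/normr0_eq0 => x0; apply/val_inj; rewrite x0 raddf0. Qed.

HB.instance Definition _ := Lmodule_isNormed.Build K X
  carrier_normD carrier_normZ carrier_norm0_eq0.

Lemma carrier_complete (G : set_system X) : ProperFilter G -> cauchy G -> cvg G.
Proof.
move=> FG /cauchyP cG.
have /cvg_ex[l /= Gl] : cvg ((val : X -> V) @ G).
  apply: cauchy_cvg; apply/cauchyP => e e0.
  have [x Gx] := cG e e0; exists (val x).
  suff sub : ball x e `<=` (val : X -> V) @^-1` ball (val x) e.
    exact: (@filterS _ G _ _ _ sub Gx).
  by move=> y; rewrite -!ball_normE.
have Fl : l \in sval (sval F).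
  apply/mem_set; apply: (@closed_cvg _ V G _ val _ _ _ l Gl).
    exact: (svalP (sval F)).
  by apply: nearW => x; apply/set_mem/(valP x).
apply: (@cvgP _ _ (Sub l Fl : X)); apply/cvgrPdist_lt => e e0.
move/cvgrPdist_lt: Gl => /(_ e e0); apply: filterS => x; exact.
Qed.

HB.instance Definition _ := Uniform_isComplete.Build X carrier_complete.

End Carrier.

(* The coarsest topology making every continuous linear functional continuous. *)
Definition weak (K : numFieldType) (X : normedModType K) : Type :=
  sup_topology (fun f : {f : {scalar X} | continuous (f : X -> K^o)} =>
    Topological.on (initial_topology (sval f : X -> K^o))).

HB.instance Definition _ (K : numFieldType) (X : normedModType K) :=
  Topological.on (weak X).

Section Games.
Variables (R : realType) (k : scalar_kind).
Local Notation K := (scalar_field R k).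
Variable X : completeNormedModType K.

Definition unit_ball : set X := [set x | `|x| <= 1].

(* The argument of [chi] is the list of the moves already made by Player II. *)
Definition winning_strategy (n : nat) (win : set (n.-tuple X))
    (chi : seq X -> set X) :=
  (forall s : seq X, (size s < n)%N -> {in s, forall x, unit_ball x} ->
     open (chi s : set (weak X)) /\ chi s 0) /\
  (forall x : n.-tuple X, (forall j, unit_ball (tnth x j)) ->
     (forall j : 'I_n, chi (take j x) (tnth x j)) -> win x).

Definition lp_norm (p : \bar R) (n : nat) (a : 'I_n -> K) : R :=
  match p with
  | r%:E => (\sum_(i < n) rnorm (a i : K^o) `^ r) `^ r^-1
  | _ => \big[Num.max/0]_(i < n) rnorm (a i : K^o)
  end.

Definition A_win (c : R) (p : \bar R) (n : nat) : set (n.-tuple X) :=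
  [set x | forall a : 'I_n -> K, lp_norm p a <= 1 ->
             rnorm (\sum_(i < n) a i *: tnth x i) <= c].

(* [fine p^-1] is 1/p, which is 0 for p infinite. *)
Definition N_win (c : R) (p : \bar R) (n : nat) : set (n.-tuple X) :=
  [set x | rnorm (\sum_(i < n) tnth x i) <= c * n%:R `^ fine p^-1].

Definition a_const_n (p : \bar R) (n : nat) : \bar R :=
  ereal_inf [set c%:E | c in [set c : R | 0 < c /\
    exists chi, winning_strategy (A_win c p (n := n)) chi]].

Definition n_const_n (p : \bar R) (n : nat) : \bar R :=
  ereal_inf [set c%:E | c in [set c : R | 0 < c /\
    exists chi, winning_strategy (N_win c p (n := n)) chi]].

Definition a_const (p : \bar R) : \bar R :=
  ereal_sup [set a_const_n p n | n in [set n | (0 < n)%N]].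

Definition n_const (p : \bar R) : \bar R :=
  ereal_sup [set n_const_n p n | n in [set n | (0 < n)%N]].

Definition class_A (p : \bar R) : Prop := (a_const p < +oo)%E.
Definition class_N (p : \bar R) : Prop := (n_const p < +oo)%E.

End Games.

Definition effros (T : topologicalType) : set_system (closed_set T) :=
  <<s [set [set F : closed_set T | sval F `&` U !=set0] | U in open] >>.
Arguments effros T : clear implicits.

Definition SB (R : realType) (k : scalar_kind) : Type :=
  closed_subspace (CDelta R k).

Definition SB_borel (R : realType) (k : scalar_kind) : set_system (SB R k) :=
  preimage_set_system setT (@sval _ _ : SB R k -> closed_set (CDelta R k))
    (effros (CDelta R k)).

(* Main.v *)
Require Import Defs.
From HB Require Import structures.
From mathcomp Require Import all_boot all_order all_algebra.
From mathcomp Require Import complex ring lra.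
From mathcomp Require Import all_classical all_reals all_analysis.

(** Player I moves among the weakly open sets of F, so the definition of the
games quantifies over functionals on F, and the unit ball of F has a countable
base of weak neighbourhoods of 0 only when the dual of F is separable. Three
observations turn this into countable quantification.

First, by the Hahn-Banach theorem ([hahn_banach], [dual_ball_extend]) the weak
topology of a closed subspace F of V is the restriction of the weak topology of
V. Player I may thus play slabs {x : |u_j x| < 1/m for j < m}, where the u_j are
contractive functionals on V ([carrier_slab_open], [carrier_weak_nbhs0]), and F
matters only through the points that Player II may choose.

Second, fix a dense sequence D of V and let Player II choose indices i such that
D i is close to F. Player I wins from a position if and only if for some m there
is a slab of V, with parameter m, that misses the set E of those D i which are
admissible for Player II and lead to a position lost for Player I. As the dual
ball is weak-star compact, it is enough that each finite part of E be missed by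
such a slab ([weakly_separated_bigcup]), and whether a given finite set of terms
of D is missed by a slab with parameter m does not depend on F. So, by induction
on the number of remaining rounds, the set of F on which Player I wins from a
given position is obtained from the sets {F : F meets U}, U open, by complements
and countable unions ([borel_D_wins]).

Third, moving the n points chosen by Player II by at most 1/n changes the norms
of the linear combinations in question by at most 1. A win of Player I with
constant c in one of the two games, with points or with indices, is therefore a
win with constant c + 1 in the other ([D_wins_of_I_wins], [I_wins_of_D_wins]).
The loss is harmless: a space belongs to the class when one natural number c
serves for all n ([sup_inf_lty]).

It remains that C(Delta) is separable ([rational_steps_dense]). *)

Set Implicit Arguments.
Unset Strict Implicit.
Unset Printing Implicit Defensive.

Import Order.TTheory GRing.Theory Num.Theory.
Import numFieldNormedType.Exports.

Local Open Scope classical_set_scope.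
Local Open Scope ring_scope.

(** * Hahn-Banach extension in abelian groups *)

Section HahnBanach.
Variable R : realType.

Section Sublinear.
Variable V : zmodType.
Implicit Types (p q l : V -> R) (x y : V).

(** Homogeneity is asked for natural multiples only, and only in the direction
that subadditivity does not give: the notion then makes sense in every abelian
group, whatever the scalars. *)
Definition sublinear p :=
  [/\ p 0 <= 0, (forall x y, p (x + y) <= p x + p y) &
      forall x n, p x *+ n <= p (x *+ n)].

Definition additive_form l := {morph l : x y / x + y}.

Lemma additive_form0 l : additive_form l -> l 0 = 0.
Proof. by move=> lD; have := lD 0 0; rewrite addr0 => h; lra. Qed.

Lemma additive_formN l x : additive_form l -> l (- x) = - l x.
Proof. by move=> lD; have := lD x (- x); rewrite subrr additive_form0// => h; lra. Qed.

Lemma additive_formMn l x n : additive_form l -> l (x *+ n) = l x *+ n.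
Proof.
by move=> lD; elim: n => [|n IH]; rewrite ?mulr0n ?additive_form0// !mulrSr lD IH.
Qed.

Lemma sublinear_ge p x : sublinear p -> - p (- x) <= p x.
Proof.
by case=> _ pD /(_ 0 0%N); rewrite mulr0n => p0; have := pD x (- x); rewrite subrr; lra.
Qed.

Lemma sublinearMn p x n : sublinear p -> p (x *+ n) <= p x *+ n.
Proof.
case=> p0 pD _; elim: n => [|n IH]; first by rewrite !mulr0n.
by rewrite !mulrSr (le_trans (pD _ _))// lerD2r.
Qed.

(** The lower bound required by Zorn's lemma. Subadditivity survives because of
any two members of a chain one lies below the other. *)
Lemma sublinear_inf_chain (A : set (V -> R)) q :
  A !=set0 -> (forall p, A p -> sublinear p /\ forall x, p x <= q x) ->
  (forall p p', A p -> A p' -> (forall x, p x <= p' x) \/ (forall x, p' x <= p x)) ->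
  sublinear (fun x => inf [set p x | p in A]) /\
  forall p x, A p -> inf [set p x | p in A] <= p x.
Proof.
move=> [p0 Ap0] Aq Atot.
have le_inf p x : A p -> inf [set p x | p in A] <= p x.
  move=> Ap; apply: ge_inf; last by exists p.
  exists (- q (- x)) => _ [p' Ap' <-]; have [sp' /(_ (- x)) p'q] := Aq _ Ap'.
  by apply: le_trans (sublinear_ge _ sp'); rewrite lerN2.
have inf_ge (z : R) x : (forall p, A p -> z <= p x) -> z <= inf [set p x | p in A].
  move=> zA; apply: lb_le_inf; first by exists (p0 x), p0.
  by move=> _ [p Ap <-]; exact: zA.
split=> //; split.
- by apply: le_trans (le_inf _ _ Ap0) _; have [[]] := Aq _ Ap0.
- move=> x y; rewrite -lerBlDr; apply/inf_ge => p Ap; rewrite lerBlDl -lerBlDr.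
  apply/inf_ge => p' Ap'; rewrite lerBlDr [leRHS]addrC.
  suff: exists2 r, A r & r x <= p x /\ r y <= p' y.
    move=> [r Ar [rp rp']]; apply: le_trans (le_inf _ _ Ar) _.
    by have [[_ rD _] _] := Aq _ Ar; rewrite (le_trans (rD _ _))// lerD.
  by have [pp'|p'p] := Atot _ _ Ap Ap'; [exists p|exists p'].
- move=> x n; apply/inf_ge => p Ap; have [[_ _ pM] _] := Aq _ Ap.
  by apply: le_trans (pM _ _); rewrite lerMn2r le_inf ?orbT.
Qed.

(** The functional p' x = inf_n (p (x + n y) - n p y) is the slope of p at
infinity in the direction y; the value n = 1 gives p' (- y) <= - p y. The
expression decreases with n, so the infimum may be taken over the multiples of
any k > 0, whence the homogeneity of p'. *)
Lemma sublinear_slope p y : sublinear p ->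
  exists p', [/\ sublinear p', forall x, p' x <= p x & p' (- y) <= - p y].
Proof.
move=> sp; have [p0 pD pM] := sp.
pose h x n := p (x + y *+ n) - p y *+ n.
have h_ge x n : - p (- x) <= h x n.
  rewrite /h; have := pD (x + y *+ n) (- x); rewrite addrAC subrr add0r.
  by have := pM y n; lra.
have le_inf x n : inf (range (h x)) <= h x n.
  by apply: ge_inf; [exists (- p (- x)) => _ [m _ <-]|exists n].
have inf_ge (z : R) x : (forall n, z <= h x n) -> z <= inf (range (h x)).
  move=> zh; apply: lb_le_inf; first by exists (h x 0%N), 0%N.
  by move=> _ [n _ <-].
have h_decr x n m : h x (n + m)%N <= h x n.
  rewrite /h !mulrnDr addrA; have := pD (x + y *+ n) (y *+ m).
  by have := sublinearMn y m sp; lra.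
exists (fun x => inf (range (h x))); split.
- split.
  + by apply: le_trans (le_inf 0 0%N) _; rewrite /h mulr0n addr0 subr0.
  + move=> x x'; rewrite -lerBlDr; apply/inf_ge => n; rewrite lerBlDl -lerBlDr.
    apply/inf_ge => m; rewrite lerBlDr [leRHS]addrC; apply: le_trans (le_inf _ (n + m)%N) _.
    rewrite /h !mulrnDr [x + x' + _]addrACA; have := pD (x + y *+ n) (x' + y *+ m); lra.
  + move=> x [|k]; first apply/inf_ge => n.
      by rewrite mulr0n /h add0r subr_ge0; exact: pM.
    apply/inf_ge => n; apply: le_trans (h_decr _ _ (n * k)%N); rewrite -mulnS.
    apply: (@le_trans _ _ (h x n *+ k.+1)); first by rewrite lerMn2r le_inf orbT.
    by rewrite /h mulrnBl -mulrnA lerD2r mulrnA -mulrnDl pM.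
- by move=> x; apply: le_trans (le_inf _ 0%N) _; rewrite /h mulr0n addr0 subr0.
- by apply: le_trans (le_inf _ 1%N) _; rewrite /h !mulr1n addNr lerBlDr addrC subrr.
Qed.

(** Zorn's lemma gives a minimal sublinear functional p below q. It coincides
with all its slopes, so p (- y) <= - p y, and p is additive. *)
Lemma sublinear_minorant q : sublinear q ->
  exists2 l, additive_form l & forall x, l x <= q x.
Proof.
move=> sq; pose T := {p | sublinear p /\ forall x, p x <= q x}.
pose le (p p' : T) := `[< forall x, sval p' x <= sval p x >].
have [p|p1 p2 p3|A Atot|[p [sp pq]] pmin] :=
    @ZL_preorder T (exist _ q (conj sq (fun=> lexx _))) le.
- exact/asboolP.
- by move=> /asboolP h1 /asboolP h2; apply/asboolP => x; exact: le_trans (h1 x).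
- have [A0|A0] := pselect (A !=set0); last first.
    exists (exist _ q (conj sq (fun=> lexx _))) => p Ap.
    by exfalso; apply: A0; exists p.
  have [|||sinf infA] := @sublinear_inf_chain [set sval p | p in A] q.
  + by case: A0 => p Ap; exists (sval p), p.
  + by move=> _ [p Ap <-]; exact: svalP p.
  + move=> _ _ [p Ap <-] [p' Ap' <-].
    by have [/asboolP|/asboolP] := Atot _ _ Ap Ap'; [right|left].
  + have infq x : inf [set p x | p in [set sval p | p in A]] <= q x.
      case: A0 => p Ap; apply: (le_trans (infA (sval p) x _)); first by exists p.
      exact: (svalP p).2.
    exists (exist (fun p => sublinear p /\ forall x, p x <= q x) _ (conj sinf infq)).
    move=> p Ap; apply/asboolP => x /=.
    by apply: infA; exists p.
- exists p => // x y; have [p0 pD _] := sp.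
  have pN z : p (- z) <= - p z.
    have [p' [sp' p'p p'z]] := sublinear_slope z sp.
    have p'q x' : p' x' <= q x' by exact: le_trans (pq x').
    have /pmin/asboolP/(_ (- z))/= pp' :
        le (exist _ p (conj sp pq))
           (exist (fun p => sublinear p /\ forall x, p x <= q x) p' (conj sp' p'q)) by exact/asboolP.
    exact: le_trans p'z.
  apply/eqP; rewrite eq_le pD /=; have := pD (x + y) (- y); rewrite addrK.
  by have := pN y; lra.
Qed.

End Sublinear.

(** The functional q' x = inf_y (q (x - i y) + u y) is sublinear, below q, and
below u on the image of i, so every additive minorant of q' extends u. The
divisibility of W is what makes q' homogeneous. *)
Lemma hahn_banach (V W : zmodType) (i : W -> V) (q : V -> R) (u : W -> R) :
  {morph i : x y / x + y} -> (forall y n, exists z : W, z *+ n.+1 = y) ->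
  sublinear q -> additive_form u -> (forall y, u y <= q (i y)) ->
  exists l, [/\ additive_form l, forall x, l x <= q x & forall y, l (i y) = u y].
Proof.
move=> iD div sq uD uq; have [q0 qD qM] := sq.
have i0 : i 0 = 0 by apply: (@addrI _ (i 0)); rewrite -iD !addr0.
have iN y : i (- y) = - i y by apply: (@addrI _ (i y)); rewrite -iD !subrr i0.
have iM y n : i (y *+ n) = i y *+ n.
  by elim: n => [|n IH]; rewrite ?mulr0n// !mulrSr iD IH.
pose h x y := q (x - i y) + u y.
have h_ge x y : - q (- x) <= h x y.
  rewrite /h; have := qD (x - i y) (- x); rewrite addrAC subrr add0r.
  by have := uq (- y); rewrite iN additive_formN//; lra.
have le_inf x y : inf (range (h x)) <= h x y.
  by apply: ge_inf; [exists (- q (- x)) => _ [m _ <-]|exists y].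
have inf_ge (z : R) x : (forall y, z <= h x y) -> z <= inf (range (h x)).
  move=> zh; apply: lb_le_inf; first by exists (h x 0), 0.
  by move=> _ [y _ <-].
have sq' : sublinear (fun x => inf (range (h x))).
  split.
  - by apply: le_trans (le_inf 0 0) _; rewrite /h i0 subr0 additive_form0// addr0.
  - move=> x x'; rewrite -lerBlDr; apply/inf_ge => y; rewrite lerBlDl -lerBlDr.
    apply/inf_ge => y'; rewrite lerBlDr [leRHS]addrC; apply: le_trans (le_inf _ (y + y')) _.
    by rewrite /h iD uD opprD [x + x' + _]addrACA; have := qD (x - i y) (x' - i y'); lra.
  - move=> x [|k]; apply/inf_ge => y.
      by rewrite mulr0n; have := h_ge 0 y; rewrite oppr0 /h; lra.
    have [z <-] := div y k.
    apply: (@le_trans _ _ (h x z *+ k.+1)); first by rewrite lerMn2r le_inf orbT.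
    by rewrite /h iM additive_formMn// mulrnDl lerD2r -mulrnBl qM.
have [l lD lq'] := sublinear_minorant sq'.
have lu y : l (i y) <= u y.
  by apply: (le_trans (lq' _)); apply: le_trans (le_inf _ y) _; rewrite /h subrr; lra.
exists l; split=> // [x|y].
  apply: (le_trans (lq' _)); apply: le_trans (le_inf _ 0) _.
  by rewrite /h i0 subr0 additive_form0// addr0.
by apply/eqP; rewrite eq_le lu /=; have := lu (- y); rewrite iN !additive_formN// lerN2.
Qed.

End HahnBanach.

(** * Dominated functionals and weak compactness of the dual ball *)

Section RealNormTheory.
Variables (R : realType) (k : scalar_kind) (V : normedModType (scalar_field R k)).
Implicit Types (x y : V) (r : R).

Lemma of_realN r : of_real k (- r) = - of_real k r.
Proof. by case: k => //=; rewrite rmorphN. Qed.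

Lemma of_real1 : of_real k (1 : R) = 1.
Proof. by case: k. Qed.

Lemma of_real_nat n : of_real k (n%:R : R) = n%:R.
Proof.
elim: n => [|n IH]; first exact: of_real0.
by rewrite !mulrSr of_realD IH of_real1.
Qed.

Lemma rnormZ (a : scalar_field R k) x :
  rnorm (a *: x) = rnorm (a : (scalar_field R k)^o) * rnorm x.
Proof. by apply: (@of_real_inj R k); rewrite of_realM !rnormE normrZ. Qed.

Lemma rnorm0 : rnorm (0 : V) = 0.
Proof. by apply: (@of_real_inj R k); rewrite rnormE normr0 of_real0. Qed.

Lemma rnorm_of_real r : rnorm (of_real k r : (scalar_field R k)^o) = `|r|.
Proof.
wlog r0 : r / 0 <= r.
  move=> H; have [/H//|/ltW r0] := leP 0 r; rewrite -normrN -H ?oppr_ge0//.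
  by rewrite of_realN (rnormN (of_real k r : (scalar_field R k)^o)).
have h0 : 0 <= of_real k r by rewrite -(of_real0 R k) ler_of_real.
by apply: (@of_real_inj R k); rewrite rnormE (ger0_norm h0) ger0_norm.
Qed.

Lemma rnormZr r x : rnorm (of_real k r *: x) = `|r| * rnorm x.
Proof. by rewrite rnormZ rnorm_of_real. Qed.

Lemma rnormMn x n : rnorm (x *+ n) = rnorm x *+ n.
Proof.
by rewrite -scaler_nat -of_real_nat rnormZr normr_nat mulr_natl.
Qed.

Lemma sublinear_rnorm : sublinear (@rnorm R k V).
Proof.
split=> [|x y|x n]; [by rewrite rnorm0|exact: ler_rnormD|by rewrite rnormMn].
Qed.

Lemma rnorm_ball x y r : ball x (of_real k r) y <-> rnorm (x - y) < r.
Proof. by rewrite -ball_normE /= -rnormE ltr_of_real. Qed.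

End RealNormTheory.

Section DualBall.
Variables (R : realType) (k : scalar_kind) (V : normedModType (scalar_field R k)).
Implicit Types (u : V -> R) (x y : V).

(** The real parts of the contractive functionals: real homogeneity is automatic
([dual_ballZ]). Working with them treats both scalar fields at once. *)
Definition dual_ball u := additive_form u /\ forall x, u x <= rnorm x.

Lemma dual_ball_norm u x : dual_ball u -> `|u x| <= rnorm x.
Proof.
by move=> [uD ux]; rewrite ler_norml ux andbT lerNl -additive_formN// -(rnormN x).
Qed.

Lemma dual_ballB u x y : dual_ball u -> u (x - y) = u x - u y.
Proof. by move=> [uD _]; rewrite uD additive_formN. Qed.

(** Write n r = m + t with m a natural number and 0 <= t <= 1. By additivity
n (u (r x) - r u x) = u (t x) - t u x, whose absolute value is at most 2 |x| for
every n. *)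
Lemma dual_ballZ u x r : dual_ball u -> u (of_real k r *: x) = r * u x.
Proof.
move=> du; have [uD _] := du; wlog r0 : r / 0 <= r.
  move=> H; have [/H//|/ltW r0] := leP 0 r.
  by rewrite -[r in LHS]opprK of_realN scaleNr additive_formN// H ?oppr_ge0// mulNr opprK.
apply/eqP; rewrite -subr_eq0 -normr_eq0 eq_le normr_ge0 andbT leNgt.
apply/negP; set e := `|_| => e0.
pose n := (Num.truncn (2 * rnorm x / e)).+1.
have n_gt : 2 * rnorm x < n%:R * e.
  by rewrite -ltr_pdivrMr// /n truncnS_gt.
have := truncn_itv (mulr_ge0 (ler0n R n) r0); set m := Num.truncn _ => /andP[mn nm].
pose t := n%:R * r - m%:R.
have t0 : 0 <= t by rewrite subr_ge0.
have t1 : t <= 1 by rewrite lerBlDr -natr1 addrC in nm *; exact: ltW.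
have unx : n%:R * (u (of_real k r *: x) - r * u x) = u (of_real k t *: x) - t * u x.
  rewrite mulrBr mulrA mulr_natl -additive_formMn// -scaler_nat scalerA.
  rewrite -of_real_nat -of_realM.
  have -> : of_real k (n%:R * r) = of_real k t + m%:R.
    by rewrite -of_real_nat -of_realD /t subrK.
  by rewrite scalerDl uD scaler_nat additive_formMn// /t mulrBl mulr_natl; lra.
have : n%:R * e <= 2 * rnorm x.
  rewrite -[n%:R in leLHS](ger0_norm (ler0n R n)) -normrM unx.
  apply: le_trans (ler_normB _ _) _; rewrite mulr_natl mulr2n lerD//.
    apply: le_trans (dual_ball_norm _ du) _.
    by rewrite rnormZr ger0_norm// ler_piMl// rnorm_ge0.
  rewrite normrM ger0_norm//; apply: le_trans (dual_ball_norm x du).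
  by rewrite ler_piMl.
by rewrite leNgt n_gt.
Qed.

(** One parameter for both the number of functionals and the width: for u
ranging over sequences in the dual ball, the slabs form a base of the weak
neighbourhoods of 0, and they shrink as m grows. *)
Definition slab (u : nat -> V -> R) (m : nat) : set V :=
  [set x | forall j, (j < m)%N -> `|u j x| < m%:R^-1].

(** A quantitative form of the assertion that 0 is not in the weak closure of
E: only for a fixed m does it pass to increasing unions. *)
Definition weakly_separated (m : nat) (E : set V) :=
  exists u : nat -> V -> R, (forall j, dual_ball (u j)) /\
    forall x, E x -> ~ slab u m x.

Lemma ultra_cvg_segment (T : Type) (U : set_system T) (f : T -> R) (a b : R) :
  UltraFilter U -> (forall t, a <= f t <= b) ->
  exists2 l, a <= l <= b & f t @[t --> U] --> l.
Proof.
move=> UU fab.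
have /(_ (f @ U) _)[|l [lab cl]] := @segment_compact R a b.
  by rewrite nbhs_simpl; apply: nearW => t /=; rewrite in_itv/=.
exists l; first by move: lab; rewrite /= in_itv.
move=> A lA; have [//|/= UnA] := in_ultra_setVsetC (f @^-1` A) UU.
by have [|y []] := cl (~` A) A _ lA.
Qed.

(** Weak-star compactness of the dual ball: the separating functionals are the
pointwise limits, along an ultrafilter on the integers, of those that separate
the sets E n. *)
Lemma weakly_separated_bigcup m (E : nat -> set V) :
  {homo E : i j / (i <= j)%N >-> i `<=` j} -> (forall n, weakly_separated m (E n)) ->
  weakly_separated m (\bigcup_n E n).
Proof.
move=> Emono /choice[u uE].
have du n j : dual_ball (u n j) by have [] := uE n.
have [U [UU sU]] := ultraFilterLemma eventually_filter.
have vP (jx : nat * V) :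
    exists l, u n jx.1 jx.2 @[n --> U] --> l /\ l <= rnorm jx.2.
  have [n|l /andP[_ lx] ul] := @ultra_cvg_segment _ U
      (fun n => u n jx.1 jx.2) (- rnorm jx.2) (rnorm jx.2) UU; last by exists l.
  by rewrite -ler_norml dual_ball_norm.
have [v {}vP] := choice vP.
have vu j x : u n j x @[n --> U] --> v (j, x) by have [] := vP (j, x).
exists (fun j x => v (j, x)); split=> [j|x [n _ Enx] vx].
  split=> [x y|x]; last by have [] := vP (j, x).
  apply: (@cvg_unique _ (@Rhausdorff R) (u n j (x + y) @[n --> U])); first exact: vu.
  have -> : (fun n => u n j (x + y)) = (fun n => u n j x + u n j y).
    by apply/funext => i; exact: (du i j).1.
  by apply: cvgD; exact: vu.
have /filter_ex[i [ni /(_ _)ui]] : U [set i | (n <= i)%N /\ forall j : 'I_m, `|u i j x| < m%:R^-1].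
  apply: filterI; first by apply: sU; exact: nbhs_infty_ge.
  apply: filter_forall => j; apply: (cvgr_norm_lt (v (val j, x)) _ _ (vx _ (ltn_ord j))).
  exact: vu.
have [_ /(_ x (Emono _ _ ni _ Enx))] := uE i; apply => j jm.
exact: (ui (Ordinal jm)).
Qed.

End DualBall.

(** * The weak topology through real functionals *)

Section WeakTopology.
Variables (R : realType) (k : scalar_kind).
Local Notation K := (scalar_field R k).
Variable X : normedModType K.
Implicit Types (u : X -> R) (x y : X).

Lemma re_dual_ball : dual_ball (fun z : K^o => re z).
Proof.
split=> [z w|z]; first by case: k z w => //= z w; rewrite raddfD.
rewrite -(ler_of_real k) rnormE; case: k z => /= z; first exact: ler_norm.
apply: le_trans (normc_ge_Re z); rewrite lecR; exact: ler_norm.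
Qed.

(** The value 0 over the reals makes [rnorm_le_re] uniform in the scalars: the
second term vanishes when a scalar is its own real part. *)
Definition imag_unit : K :=
  match k return scalar_field R k with
  | RealScalars => 0
  | ComplexScalars => 'i%C
  end.

Lemma rnorm_imag_unit : rnorm (imag_unit : K^o) <= 1.
Proof.
rewrite -(ler_of_real k) rnormE /imag_unit; case: k => /=; first by rewrite normr0.
by rewrite normc_def /= expr0n expr1n add0r sqrtr1.
Qed.

Lemma rnorm_le_re (z : K) : rnorm (z : K^o) <= `|re z| + `|re (imag_unit * z)|.
Proof.
rewrite -(ler_of_real k) rnormE /imag_unit; case: k z => /= z.
  by rewrite mul0r normr0 addr0.
rewrite mulrC ReiNIm normrN rmorphD/= [z in leLHS]complexE.
apply: le_trans (ler_normD _ _) _; rewrite normrM.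
have -> : `|'i%C| = 1 :> R[i] by rewrite normc_def /= expr0n expr1n add0r sqrtr1.
by rewrite mul1r !normc_def /= !expr0n !addr0 !sqrtr_sqr.
Qed.

Lemma scalar_dominated_continuous (f : {scalar X}) (M : R) :
  (forall x, rnorm (f x : K^o) <= M * rnorm x) -> continuous (f : X -> K^o).
Proof.
move=> fM x; apply/cvgrPdist_lt => e /gt0_of_real[r r0 ->].
have M1 : 0 < `|M| + 1 by rewrite ltr_wpDl.
near=> y.
rewrite -rnormE ltr_of_real -linearB; apply: le_lt_trans (fM _) _.
apply: (@le_lt_trans _ _ ((`|M| + 1) * rnorm (x - y))).
  by rewrite ler_wpM2r ?rnorm_ge0// (le_trans (ler_norm M))// lerDl.
rewrite mulrC -ltr_pdivlMr//; apply/rnorm_ball; near: y; apply: nbhsx_ballx.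
by rewrite -(of_real0 R k) ltr_of_real divr_gt0.
Unshelve. all: by end_near. Qed.

Lemma dual_ball_open u e : dual_ball u -> open [set x | `|u x| < e].
Proof.
move=> du; rewrite openE => x /= uxe; apply/nbhs_ballP.
exists (of_real k (e - `|u x|)); first by rewrite /= -(of_real0 R k) ltr_of_real subr_gt0.
move=> y /rnorm_ball xy /=.
have := dual_ball_norm (x - y) du; rewrite dual_ballB//.
have := lerB_dist (u y) (u x); rewrite distrC; lra.
Qed.

End WeakTopology.

(** Over the complex numbers, u is the real part of x |-> u x - i u (i x). *)
Lemma dual_ball_scalar (R : realType) k (X : normedModType (scalar_field R k))
    (u : X -> R) : dual_ball u ->
  exists2 f : {scalar X}, continuous (f : X -> (scalar_field R k)^o) &
    forall x, u x = re (f x).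
Proof.
case: k X u => X u du; have [uD _] := du.
- have ul : scalar (u : X -> scalar_field R RealScalars).
    by move=> a x y; rewrite uD (dual_ballZ x (a : R) du).
  pose f : {scalar X} := HB.pack (u : X -> scalar_field R RealScalars)
    (GRing.isLinear.Build _ X _ _ (u : X -> scalar_field R RealScalars) ul).
  exists f => //; apply: (@scalar_dominated_continuous R RealScalars X f 1) => x.
  by rewrite mul1r; exact: dual_ball_norm.
- pose i : scalar_field R ComplexScalars := 'i%C.
  pose g x : scalar_field R ComplexScalars := ((u x) -i* (u (i *: x)))%C.
  have gl : scalar g.
    move=> a x y; pose r : R := complex.Re a; pose s : R := complex.Im a.
    have aE : a = of_real ComplexScalars r + of_real ComplexScalars s * i.
      by rewrite mulrC; exact: complexE.
    have ii : i * i = -1 by rewrite -expr2; exact: sqr_i.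
    have uax z : u (a *: z) = r * u z + s * u (i *: z).
      by rewrite aE scalerDl uD -scalerA !dual_ballZ.
    rewrite /g scalerDr !uD scalerA mulrC -scalerA !uax scalerA ii scaleN1r.
    rewrite additive_formN//; apply/eqP; rewrite eq_complex /=.
    rewrite {uax aE}/r {}/s; case: a => a b /=.
    by apply/andP; split; apply/eqP; ring.
  pose f : {scalar X} := HB.pack g (GRing.isLinear.Build _ X _ _ g gl).
  exists f => //; apply: (@scalar_dominated_continuous R ComplexScalars X f 2) => x.
  apply: le_trans (rnorm_le_re _) _; rewrite mulr_natl mulr2n lerD//.
    exact: (dual_ball_norm x du).
  rewrite /= !mul0r mul1r sub0r normrN normrN.
  apply: le_trans (dual_ball_norm _ du) _; rewrite rnormZ ler_piMl ?rnorm_ge0//.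
  exact: (@rnorm_imag_unit R ComplexScalars).
Qed.

Section WeakSlabs.
Variables (R : realType) (k : scalar_kind).
Local Notation K := (scalar_field R k).
Variable X : normedModType K.

(** The neighbourhood filter of x in the supremum topology converges to x in each
of the topologies of which it is the supremum. *)
Lemma open_weak_functional (f : {scalar X}) (A : set K^o) :
  continuous (f : X -> K^o) -> open A -> open (f @^-1` A : set (weak X)).
Proof.
move=> cf oA; rewrite openE => x Ax.
pose i := exist (fun f : {scalar X} => continuous (f : X -> K^o)) f cf.
have /(_ (nbhs_filter (x : weak X))) [/(_ (fun _ => id)) /(_ i)] :=
  @cvg_sup X _ (fun f : {f : {scalar X} | continuous (f : X -> K^o)} =>
    Topological.on (initial_topology (sval f : X -> K^o))) (nbhs (x : weak X)) x.
move=> + _; apply; rewrite nbhsE; exists (f @^-1` A) => //.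
by split=> //; exists A.
Qed.

Lemma slab_open u m : (forall j, dual_ball (u j)) -> open (slab u m : set (weak X)).
Proof.
move=> du.
have op j e : open ([set x | `|u j x| < e] : set (weak X)).
  have [f cf uf] := dual_ball_scalar (du j).
  have -> : [set x | `|u j x| < e] = f @^-1` [set z : K^o | `|re z| < e].
    by apply/seteqP; split=> x /=; rewrite uf.
  by apply: open_weak_functional => //; apply: dual_ball_open; exact: re_dual_ball.
rewrite openE => x ux; rewrite /interior.
have : nbhs (x : weak X) [set y | forall j : 'I_m, `|u j y| < m%:R^-1].
  have Fx : Filter (nbhs (x : weak X)) := nbhs_filter (x : weak X).
  apply: (@filter_forall (weak X) _ (fun j : 'I_m => [set y | `|u j y| < m%:R^-1]) _ Fx) => j.
  apply: (@open_nbhs_nbhs (weak X)).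
  by split; [exact: op|exact: (ux _ (ltn_ord j))].
by apply: filterS => y uy j jm; exact: (uy (Ordinal jm)).
Qed.

Lemma scalar_bounded (f : {scalar X}) : continuous (f : X -> K^o) ->
  exists2 M, 0 < M & forall x, rnorm (f x : K^o) <= M * rnorm x.
Proof.
move=> /(_ 0) /cvgrPdist_lt /(_ 1 ltr01) /nbhs_ballP[_ /gt0_of_real[d d0 ->]] fd.
exists (2 / d); first by rewrite divr_gt0.
move=> x; have [->|x0] := eqVneq x 0; first by rewrite linear0 !rnorm0 mulr0.
have nx0 : 0 < rnorm x.
  by rewrite -(ltr_of_real k) of_real0 rnormE normr_gt0.
pose t := d / 2 / rnorm x.
have t0 : 0 < t by rewrite !divr_gt0.
have /fd : ball 0 (of_real k d) (of_real k t *: x).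
  apply/rnorm_ball; rewrite sub0r rnormN rnormZr gtr0_norm// divfK ?gt_eqF//.
  by rewrite ltr_pdivrMr// mulr_natr mulr2n ltrDl.
rewrite /= linear0 sub0r normrN linearZ/= -[of_real k t * _]/(of_real k t *: (f x : K^o)).
rewrite -(of_real1 R k) -rnormE ltr_of_real rnormZr gtr0_norm// => /ltW.
have -> : 2 / d * rnorm x = t^-1 * 1 by rewrite /t; field; rewrite !gt_eqF.
by rewrite ler_pdivlMl.
Qed.

(** The supersets of slabs form a filter, so it suffices that this filter converge
to 0 in the initial topology of each continuous functional f. After scaling, f
is controlled by the two members of the dual ball x |-> re (f x) and
x |-> re (f (i x)). *)
Lemma weak_nbhs0_slab (U : set X) : nbhs (0 : weak X) U ->
  exists u m, (forall j, dual_ball (u j)) /\ slab u m `<=` U.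
Proof.
pose W := [set A : set X | exists u m, (forall j, dual_ball (u j)) /\ slab u m `<=` A].
have d0 : dual_ball (fun _ : X => 0 : R).
  by split=> [x y|x]; [rewrite addr0|exact: rnorm_ge0].
have slab_mono u m n : (m <= n)%N -> slab u n `<=` slab u m.
  move=> mn x ux j jm; apply: (lt_le_trans (ux j (leq_trans jm mn))).
  have m0 : (0 < m)%N := leq_ltn_trans (leq0n j) jm.
  by rewrite lef_pV2 ?posrE ?ltr0n ?ler_nat// (leq_trans m0).
have FW : Filter W.
  split.
  - by exists (fun _ _ => 0), 0%N; split.
  - move=> A B [u [m [du uA]]] [v [n [dv vB]]].
    (* Interleaving the two sequences intersects the two slabs. *)
    exists (fun j => if odd j then v j./2 else u j./2), (maxn m n).*2; split.
      by move=> j; case: odd.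
    have half j p : (j < p)%N -> (p <= maxn m n)%N -> (j.*2.+1 < (maxn m n).*2)%N.
      by move=> jp pmn; rewrite -doubleS leq_double (leq_trans jp).
    have inv_le p : (0 < p)%N -> (p <= maxn m n)%N ->
        (maxn m n).*2%:R^-1 <= p%:R^-1 :> R.
      move=> p0 pmn; rewrite lef_pV2 ?posrE ?ltr0n ?double_gt0 ?(leq_trans p0)//.
      by rewrite ler_nat (leq_trans pmn)// -addnn leq_addr.
    move=> x wx; split; [apply: uA|apply: vB] => j jp.
    + have := wx j.*2 (ltnW (half _ _ jp (leq_maxl _ _))).
      rewrite odd_double doubleK => /lt_le_trans; apply.
      by apply: inv_le; rewrite ?leq_maxl// (leq_ltn_trans _ jp).
    + have := wx j.*2.+1 (half _ _ jp (leq_maxr _ _)).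
      rewrite /= odd_double /= uphalf_double => /lt_le_trans; apply.
      by apply: inv_le; rewrite ?leq_maxr// (leq_ltn_trans _ jp).
  - by move=> A B AB [u [m [du uA]]]; exists u, m; split=> //; exact: subset_trans AB.
suff subW (i : {f : {scalar X} | continuous (f : X -> K^o)}) :
    nbhs (0 : initial_topology (sval i : X -> K^o)) `<=` W.
  by move=> U0; exact: ((cvg_sup (fun f : {f : {scalar X} | continuous (f : X -> K^o)} =>
    Topological.on (initial_topology (sval f : X -> K^o))) 0 FW).2 subW U U0).
case: i => f cf A.
rewrite nbhsE => -[B [[C oC <-] C0]] CA.
have /= : nbhs (f 0 : K^o) C by apply: open_nbhs_nbhs.
rewrite linear0 => /nbhs_ballP[_ /gt0_of_real[e e0 ->]] eC.
have [M M0 fM] := scalar_bounded cf.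
pose v j x := re (f ((if j == 0%N then 1 else imag_unit R k) *: x)) / M.
pose m := (maxn 2 (Num.truncn (2 * M / e)).+1).
have dv j : dual_ball (v j).
  split=> [x y|x]; first by rewrite /v scalerDr linearD (re_dual_ball R k).1 mulrDl.
  rewrite /v ler_pdivrMr// mulrC; apply: le_trans ((re_dual_ball R k).2 _) _.
  apply: le_trans (fM _) _; rewrite ler_pM2l// rnormZ ler_piMl ?rnorm_ge0//.
  case: eqP => _; last exact: rnorm_imag_unit.
  by rewrite -(of_real1 R k) rnorm_of_real normr1.
exists v, m; split=> // x vx; apply: CA; apply: eC.
apply/(@rnorm_ball R k K^o).
rewrite sub0r rnormN; apply: le_lt_trans (rnorm_le_re _) _.
have m2 : (1 < m)%N := leq_maxl _ _.
have v0 : `|re (f x)| < M / m%:R.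
  have := vx 0%N (ltnW m2); rewrite /v eqxx scale1r normrM normfV (gtr0_norm M0).
  by rewrite ltr_pdivrMr// mulrC.
have v1 : `|re (imag_unit R k * f x)| < M / m%:R.
  have := vx 1%N m2; rewrite /v /= linearZ normrM normfV (gtr0_norm M0).
  by rewrite ltr_pdivrMr// mulrC.
have mM : 2 * M / e <= m%:R.
  rewrite (le_trans (ltW (truncnS_gt _)))// ler_nat; exact: leq_maxr.
have m0 : 0 < m%:R :> R by rewrite ltr0n ltnW.
rewrite ler_pdivrMr// in mM.
have : M / m%:R * 2 <= e.
  by rewrite mulrAC ler_pdivrMr// mulrC [leRHS]mulrC.
lra.
Qed.

End WeakSlabs.

Section SubspaceWeakTopology.
Variables (R : realType) (k : scalar_kind).
Local Notation K := (scalar_field R k).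
Variables (V : completeNormedModType K) (F : closed_subspace V).

Lemma dual_ball_val u : dual_ball u -> dual_ball (fun x : carrier F => u (val x)).
Proof. by move=> [uD ux]; split=> [x y|x]; [rewrite raddfD uD|exact: ux]. Qed.

Lemma dual_ball_extend (w : carrier F -> R) : dual_ball w ->
  exists2 u : V -> R, dual_ball u & forall x, u (val x) = w x.
Proof.
move=> [wD wx].
have [|y n|||l [lD lq lw]] := @hahn_banach R V (carrier F) val (@rnorm R k V) w _ _ _ wD.
- exact: raddfD.
- exists (n.+1%:R^-1 *: y); rewrite -[LHS]scaler_nat scalerA divff ?scale1r//.
- exact: sublinear_rnorm.
- exact: wx.
- by exists l.
Qed.

Lemma carrier_slab_open u m : (forall j, dual_ball (u j)) ->
  open ([set x | slab u m (val x)] : set (weak (carrier F))).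
Proof.
move=> du; apply: (@slab_open _ _ (carrier F) (fun j x => u j (val x))) => j.
exact: dual_ball_val.
Qed.

Lemma carrier_weak_nbhs0 (U : set (carrier F)) :
  open (U : set (weak (carrier F))) -> U 0 ->
  exists u m, (forall j, dual_ball (u j)) /\ forall x, slab u m (val x) -> U x.
Proof.
move=> oU U0; have [|w [m [dw wU]]] := @weak_nbhs0_slab _ _ _ U.
  exact: (@open_nbhs_nbhs (weak (carrier F)) 0 U).
have /choice[u uw] j : exists v : V -> R, dual_ball v /\ forall x, v (val x) = w j x.
  by have [v] := dual_ball_extend (dw j); exists v.
have du j : dual_ball (u j) by have [] := uw j.
exists u, m; split=> // x ux; apply: wU => j jm.
by have [_ <-] := uw j; exact: ux.
Qed.

End SubspaceWeakTopology.

(** * Games and their discretization *)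

Section GameTree.
Variables (R : realType) (k : scalar_kind).
Variable X : completeNormedModType (scalar_field R k).
Implicit Types (G : set (seq X)) (s : seq X).

(** The game unfolded by backward induction, r being the number of rounds left. *)
Fixpoint I_wins G (r : nat) s : Prop :=
  if r is r'.+1 then
    exists U : set X, [/\ open (U : set (weak X)), U 0 &
      forall x, unit_ball x -> U x -> I_wins G r' (rcons s x)]
  else G s.

Lemma winning_strategyP n G :
  (exists chi, winning_strategy (fun x : n.-tuple X => G x) chi) <-> I_wins G n [::].
Proof.
split=> [[chi [chi_open chi_win]]|Gn].
  suff H r s : (size s + r = n)%N -> (forall j, (j < size s)%N ->
      unit_ball (nth 0 s j) /\ chi (take j s) (nth 0 s j)) -> I_wins G r s.
    by apply: H.
  elim: r s => [|r IH] s sn sP /=.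
    rewrite addn0 in sn; have /eqP sn' := sn.
    apply: (chi_win (Tuple sn')) => j; rewrite (tnth_nth 0) /=;
      have [] := sP j; by rewrite ?sn.
  have [||oU U0] := chi_open s; first by rewrite -sn addnS leq_addr.
    by move=> x /(nthP 0)[j js <-]; have [] := sP j js.
  exists (chi s); split=> // x Bx Ux; apply: IH; first by rewrite size_rcons addSnnS.
  move=> j; rewrite size_rcons nth_rcons ltnS leq_eqVlt => /orP[/eqP ->|js].
    by rewrite ltnn eqxx -cats1 take_size_cat.
  by rewrite js -cats1 takel_cat ?(ltnW js)//; exact: sP.
have /choice[chi chiP] s : exists U : set X, [/\ open (U : set (weak X)), U 0 &
    I_wins G (n - (size s).+1).+1 s ->
    forall x, unit_ball x -> U x -> I_wins G (n - (size s).+1) (rcons s x)].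
  have [[U [oU U0 UG]]|nG] := pselect (I_wins G (n - (size s).+1).+1 s).
    by exists U; split.
  by exists setT; split=> //; exact: openT.
exists chi; split=> [s _ _|x xB xchi]; first by have [] := chiP s.
suff H j : (j <= n)%N -> I_wins G (n - j) (take j x).
  by have := H _ (leqnn n); rewrite subnn take_oversize ?size_tuple.
elim: j => [_|j IH jn]; first by rewrite take0 subn0.
have sj : size (take j x) = j by rewrite size_takel// size_tuple ltnW.
have [_ _] := chiP (take j x); rewrite sj -subSn// subSS.
move=> /(_ (IH (ltnW jn)) (nth 0 x j)).
rewrite (take_nth 0) ?size_tuple//; apply.
  by have := xB (Ordinal jn); rewrite (tnth_nth 0).
by have := xchi (Ordinal jn); rewrite (tnth_nth 0).
Qed.

End GameTree.

Section DiscreteGame.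
Variables (R : realType) (k : scalar_kind).
Local Notation K := (scalar_field R k).
Variables (V : completeNormedModType K) (D : nat -> V).
Implicit Types (F : closed_subspace V) (G : set (seq V)) (s : seq nat).

(** The ball is open so that meeting this set is an Effros-Borel condition on F;
points of the closed ball are approximated from inside. *)
Definition unit_trace (m : nat) (d : V) : set V :=
  [set x | rnorm x < 1 /\ rnorm (x - d) < m.+1%:R^-1].

Definition hits F (U : set V) := sval (sval F) `&` U !=set0.

(** The game in which Player II names indices into D. Given m, Player II may name
i when D i is within 1/(m+1) of a point of F of norm < 1, and Player I needs a
slab that misses all D i from which the rest of the game is not won. The bound
i < n is where compactness enters: slabs are demanded for the finite parts of
this set only, with m independent of n. *)
Fixpoint D_wins F G (r : nat) s : Prop :=
  if r is r'.+1 then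
    exists m, forall n, weakly_separated m.+1
      [set D i | i in [set i | [/\ (i < n)%N, hits F (unit_trace m (D i)) &
                                 ~ D_wins F G r' (rcons s i)]]]
  else G (map D s).

Variable F : closed_subspace V.
Local Notation X := (carrier F).

Lemma carrier_unit_ball (x : X) : unit_ball x <-> rnorm (val x) <= 1.
Proof.
rewrite /unit_ball /= -(of_real1 R k) -rnormE ler_of_real; split; exact.
Qed.

Definition close_pair (e : R) : pred (X * nat) := fun z => rnorm (val z.1 - D z.2) < e.

(** Player I answers the index i as if Player II had chosen a point y of F close to
D i. With 1/(M+1) <= 1/(2m), a D i in the slab of parameter M+1 puts y in the
slab of parameter m. *)
Lemma D_wins_of_I_wins (G : set (seq X)) (G' : set (seq V)) (n : nat) (e : R) :
  0 < e ->
  (forall z : seq (X * nat), size z = n -> all (close_pair e) z ->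
     G (unzip1 z) -> G' (map D (unzip2 z))) ->
  forall r z, (size z + r = n)%N -> all (close_pair e) z ->
    I_wins G r (unzip1 z) -> D_wins F G' r (unzip2 z).
Proof.
move=> e0 GG'; elim=> [|r IH] z zn ze; first by rewrite addn0 in zn; exact: GG'.
move=> /= [U [oU U0 UG]]; have [u [m [du uU]]] := carrier_weak_nbhs0 oU U0.
pose M := maxn m.*2 (Num.truncn e^-1).
have M0 : 0 < M.+1%:R :> R by rewrite ltr0n.
have Me : M.+1%:R^-1 < e.
  rewrite -(invrK e) ltf_pV2 ?posrE ?invr_gt0//.
  by apply: lt_le_trans (truncnS_gt _) _; rewrite ler_nat ltnS leq_maxr.
exists M => l; exists u; split=> // _ [i [_ [y [Fy [y1 yi]]] nD] <-] ui; apply: nD.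
pose x : X := exist _ y (mem_set Fy).
rewrite -[i in rcons _ i]/(snd (x, i)) -map_rcons; apply: IH.
- by rewrite size_rcons addSnnS.
- by rewrite all_rcons ze andbT /close_pair /=; exact: lt_trans Me.
rewrite [unzip1 _]map_rcons; apply: UG; first by apply/carrier_unit_ball; exact: ltW.
apply: uU => j jm /=.
have jM : (j < M.+1)%N.
  by rewrite ltnS (leq_trans (ltnW jm))// (leq_trans _ (leq_maxl _ _))// -addnn leq_addr.
have h1 := dual_ball_norm (y - D i) (du j); rewrite dual_ballB// in h1.
have h2 : `|u j y| <= `|u j (D i)| + `|u j y - u j (D i)|.
  by rewrite -lerBlDl; exact: lerB_dist.
have h3 := ui j jM.
have m0 : 0 < m%:R :> R by rewrite ltr0n (leq_ltn_trans _ jm).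
have h4 : M.+1%:R^-1 * 2 <= m%:R^-1 :> R.
  rewrite mulrC ler_pdivrMr// ler_pdivlMl// -natrM ler_nat.
  by rewrite muln2 (leq_trans (leq_maxl m.*2 (Num.truncn e^-1)))// leqnSn.
apply: (le_lt_trans h2); apply: lt_le_trans (ltrD h3 (le_lt_trans h1 yi)) _.
by apply: le_trans h4; rewrite mulr_natr mulr2n.
Qed.

(** Player I answers a point x as if Player II had named an index i with D i close
to x. The slab is taken twice as thin as required by the game with indices, to
absorb the distance from x to D i. *)
Lemma I_wins_of_D_wins (G : set (seq V)) (G' : set (seq X)) (n : nat) (e : R) :
  (forall x d, 0 < d -> exists i, rnorm (x - D i) < d) -> 0 < e ->
  (forall z : seq (X * nat), size z = n -> all (close_pair e) z ->
     G (map D (unzip2 z)) -> G' (unzip1 z)) ->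
  forall r z, (size z + r = n)%N -> all (close_pair e) z ->
    D_wins F G r (unzip2 z) -> I_wins G' r (unzip1 z).
Proof.
move=> Ddense e0 GG'; elim=> [|r IH] z zn ze; first by rewrite addn0 in zn; exact: GG'.
move=> /= [m] /weakly_separated_bigcup[].
  by move=> i j ij _ [l [li lF nD] <-]; exists l => //; split=> //; exact: leq_trans ij.
move=> u [du uE].
exists [set x | slab u m.+1.*2 (val x)]; split.
- exact: carrier_slab_open.
- move=> j jm /=; have [uD _] := du j; rewrite additive_form0// normr0 invr_gt0.
  by rewrite ltr0n double_gt0.
move=> x /carrier_unit_ball x1 ux.
pose q : R := m.+1.*2%:R^-1.
have q0 : 0 < q by rewrite invr_gt0 ltr0n double_gt0.
have q2 : q + q = m.+1%:R^-1.
  have : m.+1%:R != 0 :> R by rewrite pnatr_eq0.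
  by rewrite /q -muln2 natrM; set a := m.+1%:R => a0; field.
have q1 : q <= 1 by rewrite invf_le1 ?ltr0n ?double_gt0// ler1n double_gt0.
have [|i] := Ddense (val x) (Num.min e (q / 2)); first by rewrite lt_min e0 divr_gt0.
rewrite lt_min => /andP[xie xiq].
rewrite -[x in rcons _ x]/(fst (x, i)) -map_rcons; apply: IH.
- by rewrite size_rcons addSnnS.
- by rewrite all_rcons ze andbT.
rewrite [unzip2 _]map_rcons /=; apply: contrapT => nD.
apply: (uE (D i)).
  exists i.+1 => //; exists i => //; split=> //.
  (* x may have norm 1, and admissibility asks for a point of norm < 1. *)
  pose y := of_real k (1 - q / 2) *: val x.
  have Fy : sval (sval F) y.
    apply/set_mem; have := svalP F => -[_ /(_ (of_real k (1 - q / 2)) (val x) 0)].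
    by rewrite addr0; apply; [exact: (valP x)|have [] := svalP F].
  exists y; split=> //; split.
    rewrite rnormZr ger0_norm ?subr_ge0; last by lra.
    apply: (@le_lt_trans _ _ ((1 - q / 2) * 1)); last by lra.
    by rewrite ler_wpM2l//; lra.
  have -> : y - D i = (val x - D i) - of_real k (q / 2) *: val x.
    by rewrite /y of_realD of_realN of_real1 scalerBl scale1r addrAC.
  rewrite -q2; apply: le_lt_trans (ler_rnormD _ _) _; rewrite rnormN rnormZr.
  rewrite ger0_norm; last by lra.
  have : q / 2 * rnorm (val x) <= q / 2 * 1 by rewrite ler_wpM2l//; lra.
  lra.
move=> j jm; rewrite -q2.
have h1 := dual_ball_norm (val x - D i) (du j); rewrite dual_ballB// in h1.
have h2 : `|u j (D i)| <= `|u j (val x)| + `|u j (val x) - u j (D i)|.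
  by rewrite -lerBlDl distrC; exact: lerB_dist.
have : `|u j (val x)| < q by apply: ux; rewrite (leq_trans jm)// -addnn leq_addr.
lra.
Qed.

End DiscreteGame.

(** * The Effros-Borel structure on subspaces *)

Section Borel.
Variables (R : realType) (k : scalar_kind).
Variable V : completeNormedModType (scalar_field R k).

Definition subspace_borel : set_system (closed_subspace V) :=
  preimage_set_system setT (@sval _ _ : closed_subspace V -> closed_set V) (effros V).

Lemma subspace_borel_sigma : sigma_algebra setT subspace_borel.
Proof. exact/sigma_algebra_preimage/smallest_sigma_algebra. Qed.

Lemma borel_equiv (A B : closed_subspace V -> Prop) :
  (forall F, A F <-> B F) -> subspace_borel [set F | A F] ->
  subspace_borel [set F | B F].
Proof.
by move=> AB; suff -> : [set F | B F] = [set F | A F] by []; apply/seteqP; split=> F /AB.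
Qed.

Lemma borel_not (A : closed_subspace V -> Prop) :
  subspace_borel [set F | A F] -> subspace_borel [set F | ~ A F].
Proof. by case: subspace_borel_sigma => _ + _ => /[apply]; rewrite setTD. Qed.

Lemma borel_const (P : Prop) : subspace_borel [set _ | P].
Proof.
have [b0 _ _] := subspace_borel_sigma.
have [p|np] := pselect P; last by move: b0; exact: borel_equiv.
by move: (borel_not b0); apply: borel_equiv => F; split=> // _ [].
Qed.

Lemma borel_exists (I : countType) (A : I -> closed_subspace V -> Prop) :
  (forall i, subspace_borel [set F | A i F]) ->
  subspace_borel [set F | exists i, A i F].
Proof.
move=> bA; have [b0 _ bU] := subspace_borel_sigma.
pose B n := if unpickle n is Some i then [set F | A i F] else set0.
have : subspace_borel (\bigcup_n B n).
  by apply: bU => n; rewrite /B; case: unpickle.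
apply: borel_equiv => F; split.
  by move=> [n _]; rewrite /B; case: unpickle => // i AiF; exists i.
by case=> i AiF; exists (pickle i) => //; rewrite /B pickleK.
Qed.

Lemma borel_forall (I : countType) (A : I -> closed_subspace V -> Prop) :
  (forall i, subspace_borel [set F | A i F]) ->
  subspace_borel [set F | forall i, A i F].
Proof.
move=> bA; have := borel_not (borel_exists (fun i => borel_not (bA i))).
apply: borel_equiv => F; split; last by move=> AF [i nAi]; exact: nAi (AF i).
by move=> nA i; apply: contrapT => nAi; apply: nA; exists i.
Qed.

Lemma borel_imply (P : Prop) (A : closed_subspace V -> Prop) :
  (P -> subspace_borel [set F | A F]) -> subspace_borel [set F | P -> A F].
Proof.
move=> bA; have [p|np] := pselect P.
  by apply: borel_equiv (bA p) => F; split=> // /(_ p).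
by apply: borel_equiv (borel_const True) => F; split.
Qed.

Lemma borel_and (A B : closed_subspace V -> Prop) :
  subspace_borel [set F | A F] -> subspace_borel [set F | B F] ->
  subspace_borel [set F | A F /\ B F].
Proof.
move=> bA bB.
have bAB b : subspace_borel [set F | (if b then A else B) F] by case: b.
apply: borel_equiv (borel_forall bAB) => F; split.
  by move=> AB; split; [exact: AB true|exact: AB false].
by move=> [AF BF] [].
Qed.

Lemma borel_hits U : open U -> subspace_borel [set F | hits F U].
Proof.
move=> oU; exists [set F : closed_set V | sval F `&` U !=set0]; last by rewrite setTI.
by apply: sub_sigma_algebra; exists U.
Qed.

(** The trace on {0, ..., n-1} takes finitely many values, each on a Borel set;
they are enumerated by finite sequences of integers. *)
Lemma borel_finite_trace (A : nat -> closed_subspace V -> Prop) (Q : set nat -> Prop) n :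
  (forall i, subspace_borel [set F | A i F]) ->
  subspace_borel [set F | Q [set i | (i < n)%N /\ A i F]].
Proof.
move=> bA; have : subspace_borel [set F | exists s : seq nat,
    Q [set i | (i < n)%N /\ i \in s] /\ forall i, (i < n)%N -> (i \in s <-> A i F)].
  apply: borel_exists => s; apply: borel_and; first exact: borel_const.
  apply: borel_forall => i; apply: borel_imply => _; have [si|si] := boolP (i \in s).
    by apply: borel_equiv (bA i) => F; split=> // -[+ _]; exact.
  by apply: borel_equiv (borel_not (bA i)) => F; split=> // [[_ +]] AF => /(_ AF).
apply: borel_equiv => F; split.
  move=> [s [+ sA]]; congr Q; apply/seteqP; split=> i /= [lt_in];
    by move=> /(sA _ lt_in).
move=> QF; exists [seq i <- iota 0 n | `[< A i F >]]; split.
  move: QF; congr Q; apply/seteqP; split=> i /= [lt_in]; rewrite mem_filter.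
    by move=> AiF; rewrite mem_iota add0n lt_in leq0n !andbT; split=> //; exact/asboolP.
  by move=> /andP[/asboolP].
by move=> i lt_in; rewrite mem_filter mem_iota add0n lt_in leq0n !andbT; split => /asboolP.
Qed.

Lemma unit_trace_open m (d : V) : open (unit_trace m d).
Proof.
have -> : unit_trace m d = ball 0 (of_real k 1) `&` ball d (of_real k m.+1%:R^-1).
  apply/seteqP; split=> x /=; rewrite !rnorm_ball sub0r rnormN -(rnormN (d - x)) opprB;
    by case.
by apply: openI; apply: ball_open; rewrite -(of_real0 R k) ltr_of_real ?invr_gt0.
Qed.

(** Being weakly separated is a property of subsets of V in which F does not
occur, so only the Borel dependence on F of the finitely many relevant indices
matters. *)
Lemma borel_D_wins (D : nat -> V) (G : set (seq V)) r s :
  subspace_borel [set F | D_wins D F G r s].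
Proof.
elim: r s => [|r IH] s; first exact: borel_const.
apply: borel_exists => m; apply: borel_forall => n.
pose A i (F : closed_subspace V) :=
  hits F (unit_trace m (D i)) /\ ~ D_wins D F G r (rcons s i).
have bA i : subspace_borel [set F | A i F].
  by apply: borel_and; [exact: borel_hits (unit_trace_open _ _)|exact: borel_not].
apply: borel_equiv (borel_finite_trace (fun I => weakly_separated m.+1 (D @` I)) n bA).
move=> F; suff -> : [set i | (i < n)%N /\ A i F] = [set i | [/\ (i < n)%N,
    hits F (unit_trace m (D i)) & ~ D_wins D F G r (rcons s i)]] by [].
by apply/seteqP; split=> i []// ? [].
Qed.

End Borel.

(** * Separability of the space of continuous functions on the Cantor space *)

Section CantorCylinders.

Lemma cantor_coordinate_near (x : cantor_space) (i : nat) :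
  nbhs x [set y : cantor_space | y i = x i].
Proof.
have := @proj_continuous _ (fun _ : nat => bool) i x => /(_ [set x i]).
by apply; exact: discrete_set1.
Qed.

Lemma cantor_cylinder_near (x : cantor_space) (N : nat) :
  nbhs x [set y : cantor_space | forall i, (i < N)%N -> y i = x i].
Proof.
have := @filter_forall cantor_space _
  (fun i : 'I_N => [set y : cantor_space | y i = x i]) (nbhs x) (nbhs_filter x).
move=> /(_ (fun i => cantor_coordinate_near x i)).
by apply: filterS => y yx i iN; exact: (yx (Ordinal iN)).
Qed.

(** The supersets of cylinders form a filter that converges to x coordinatewise. *)
Lemma cantor_nbhs_cylinder (x : cantor_space) (A : set cantor_space) :
  nbhs x A -> exists N, [set y : cantor_space | forall i, (i < N)%N -> y i = x i] `<=` A.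
Proof.
pose W := filter_from [set: nat]
  (fun N => [set y : cantor_space | forall i, (i < N)%N -> y i = x i]).
have FW : Filter W.
  apply: filter_from_filter; first by exists 0%N.
  move=> m n _ _; exists (maxn m n) => // y yx.
  by split=> i im; apply: yx; rewrite leq_max im ?orbT.
suff subW i : nbhs (x : initial_topology (fun f : nat -> bool => f i)) `<=` W.
  by move=> xA; have [N _ NA] := (cvg_sup (fun i => Topological.class
    (initial_topology (fun f : nat -> bool => f i))) x FW).2 subW A xA; exists N.
move=> B; rewrite nbhsE => -[_ [[C oC <-] Cx]] CB.
by exists i.+1 => // y yx; apply: CB; rewrite /= yx.
Qed.

End CantorCylinders.

Section Separable.
Variables (R : realType) (k : scalar_kind).
Local Notation K := (scalar_field R k).
Local Notation C := (CDelta R k).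

Definition rational_scalar (q : rat * rat) : K :=
  match k return scalar_field R k with
  | RealScalars => ratr q.1
  | ComplexScalars => ((ratr q.1) +i* (ratr q.2))%C
  end.

Lemma rational_scalar_dense (z : K) e : 0 < e ->
  exists q, rnorm (z - rational_scalar q : K^o) < e.
Proof.
move=> e0; have ratP (x : R) d : 0 < d -> exists q : rat, `|x - ratr q| < d.
  move=> d0; have [q] := @rat_in_itvoo R (x - d) (x + d) ltac:(lra).
  rewrite in_itv /= => /andP[h1 h2]; exists q.
  by rewrite ltr_norml; apply/andP; split; lra.
have e20 : 0 < e / 2 by rewrite divr_gt0.
rewrite /rational_scalar; case: k z => /= z.
  have [q zq] := ratP z e e0; exists (q, 0).
  by rewrite -(ltr_of_real RealScalars) rnormE.
have [q zq] := ratP (complex.Re z) _ e20; have [r zr] := ratP (complex.Im z) _ e20.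
exists (q, r); apply: le_lt_trans (@rnorm_le_re R ComplexScalars _) _ => /=.
case: z zq zr => a b /= zq zr.
rewrite !mul0r mul1r sub0r normrN; lra.
Qed.

Definition step (N : nat) (g : N.-tuple bool -> K) (x : cantor_space) : K :=
  g [tuple x i | i < N].

Lemma step_continuous N (g : N.-tuple bool -> K) : continuous (step g).
Proof.
move=> x; apply: cvg_near_cst; apply: filterS (cantor_cylinder_near x N) => y yx.
by congr g; apply: eq_from_tnth => i; rewrite !tnth_mktuple yx.
Qed.

(** Otherwise there are, for each N, two points with the same first N coordinates
and values of f at distance at least e; a cluster point of the first ones
contradicts the continuity of f. *)
Lemma cd_cylinder_uniform (f : C) e : 0 < e -> exists N, forall x y : cantor_space,
  (forall i, (i < N)%N -> x i = y i) -> rnorm (cd_fun f x - cd_fun f y : K^o) < e.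
Proof.
move=> e0; apply: contrapT => /forallNP nN.
have /choice[xy xyP] N : exists xy : cantor_space * cantor_space,
    (forall i, (i < N)%N -> xy.1 i = xy.2 i) /\
    e <= rnorm (cd_fun f xy.1 - cd_fun f xy.2 : K^o).
  apply: contrapT => /forallNP nxy; apply: (nN N) => x y xy.
  by rewrite ltNge; apply/negP => exy; apply: (nxy (x, y)).
have [x [_ clx]] := @cantor_space_compact ((fun n => (xy n).1) @ \oo) _ filterT.
pose A := [set z | rnorm (cd_fun f x - cd_fun f z : K^o) < e / 2].
have xA : nbhs x A.
  have e0' : 0 < of_real k (e / 2) by rewrite -(of_real0 R k) ltr_of_real divr_gt0.
  have /(@cvgrPdist_lt _ K^o)/(_ _ e0') := @cts_fun _ _ f x.
  by apply: filterS => z; rewrite -(rnormE (_ : K^o)) ltr_of_real.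
have [N NA] := cantor_nbhs_cylinder xA.
have [|z [[n Nn <-] zx]] := clx ((fun n => (xy n).1) @` [set n | (N <= n)%N])
    _ _ (cantor_cylinder_near x N).
  by apply: filterS (nbhs_infty_ge N) => n Nn; exists n.
have [xyn] := xyP n; rewrite leNgt => /negP; apply.
have A1 : A (xy n).1 by exact: NA.
have A2 : A (xy n).2.
  by apply: NA => i iN; rewrite -xyn ?zx// (leq_trans iN).
have -> : cd_fun f (xy n).1 - cd_fun f (xy n).2 =
  (cd_fun f x - cd_fun f (xy n).2) - (cd_fun f x - cd_fun f (xy n).1).
  by rewrite opprB [RHS]addrC subrKA.
apply: le_lt_trans (@ler_rnormD R k K^o _ _) _; rewrite rnormN.
by rewrite (splitr e); apply: ltrD.
Qed.

Definition rational_step (c : {N : nat & {ffun N.-tuple bool -> rat * rat}}) : C :=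
  cd_of (@step_continuous _ (fun t => rational_scalar (tagged c t))).

Definition rational_steps (n : nat) : C :=
  if unpickle n is Some c then rational_step c else 0.

Lemma rational_steps_dense (f : C) e : 0 < e ->
  exists n, rnorm (f - rational_steps n) < e.
Proof.
move=> e0; have e40 : 0 < e / 4 by rewrite divr_gt0.
have [N fN] := cd_cylinder_uniform f e40.
have /choice[g gP] (t : N.-tuple bool) : exists q, rnorm
    (cd_fun f (fun i => nth false t i) - rational_scalar q : K^o) < e / 4.
  exact: rational_scalar_dense.
pose c : {N : nat & {ffun N.-tuple bool -> rat * rat}} := Tagged _ [ffun t => g t].
exists (pickle c); rewrite /rational_steps pickleK.
rewrite /rnorm /= [X in re X < _]/(cd_norm _) of_realK.
apply: (@le_lt_trans _ _ (e / 2)); last by lra.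
apply: cd_sup_le => x; pose t := [tuple x i | i < N]; pose y : cantor_space := nth false t.
have /fN xy i : (i < N)%N -> x i = y i.
  by move=> iN; rewrite /y -[i in RHS]/(val (Ordinal iN)) -tnth_nth tnth_mktuple.
have -> : cd_fun (f - rational_step c) x =
    (cd_fun f x - cd_fun f y) + (cd_fun f y - rational_scalar (g t)).
  by rewrite subrKA; congr (_ - rational_scalar _); rewrite /= ffunE.
apply: le_trans (@ler_rnormD R k K^o _ _) _.
by have := gP t; rewrite -/y; lra.
Qed.

End Separable.

(** * Winning conditions given by bounds on linear combinations *)

Section CombinationGames.
Variables (R : realType) (k : scalar_kind).
Local Notation K := (scalar_field R k).

(** The common form of the two winning conditions: S is the unit ball of l_p and
M = c in the game A, S is the single vector (1, ..., 1) and M = c n^(1/p) in the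
game N. *)
Definition bounded_combinations (V : normedModType K) (n : nat)
    (S : set ('I_n -> K)) (M : R) : set (seq V) :=
  [set s | forall a, S a -> rnorm (\sum_(i < n) a i *: s`_i) <= M].

Lemma rnorm_sum (V : normedModType K) n (x : 'I_n -> V) :
  rnorm (\sum_(i < n) x i) <= \sum_(i < n) rnorm (x i).
Proof.
elim/big_ind2: _ => [|x1 r1 x2 r2 h1 h2|//]; first by rewrite rnorm0.
by apply: le_trans (ler_rnormD _ _) _; exact: lerD.
Qed.

(** Each of the n terms moves by at most 1/n. *)
Lemma rnorm_combination_perturb (V : normedModType K) n (a : 'I_n -> K) (x y : 'I_n -> V) :
  (forall i, rnorm (a i : K^o) <= 1) -> (forall i, rnorm (x i - y i) <= n%:R^-1) ->
  rnorm (\sum_(i < n) a i *: x i) <= rnorm (\sum_(i < n) a i *: y i) + 1.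
Proof.
move=> a1 xy; rewrite -lerBlDl.
have h : rnorm (\sum_(i < n) a i *: x i) - rnorm (\sum_(i < n) a i *: y i) <=
    rnorm (\sum_(i < n) a i *: x i - \sum_(i < n) a i *: y i).
  exact: le_trans (ler_norm _) (rnorm_dist _ _).
apply: (le_trans h); rewrite -sumrB; apply: le_trans (rnorm_sum _) _.
apply: (@le_trans _ _ (\sum_(i < n) n%:R^-1)).
  apply: ler_sum => i _; rewrite -scalerBr rnormZ; apply: le_trans (xy i).
  by rewrite ler_piMl ?rnorm_ge0.
rewrite sumr_const card_ord; case: n {a x y a1 xy h} => [|n]; first by rewrite mulr0n.
by rewrite -[leLHS]mulr_natl divff// pnatr_eq0.
Qed.

Variables (V : completeNormedModType K) (D : nat -> V).
Hypothesis Ddense : forall x d, 0 < d -> exists i, rnorm (x - D i) < d.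

(* The coefficients are at most 1 and the bounds at least 1: these two properties,
shared by both games, let an increment of c by 1 absorb a perturbation of size
1/n of the points. *)
Variables (S : forall n, set ('I_n -> K)) (b : nat -> R).
Hypothesis S_le1 : forall n a, S a -> forall i : 'I_n, rnorm (a i : K^o) <= 1.
Hypothesis b_ge1 : forall n, (0 < n)%N -> 1 <= b n.

Lemma close_combinations (F : closed_subspace V) n (c : R) (z : seq (carrier F * nat)) :
  (0 < n)%N -> size z = n -> all (close_pair D n%:R^-1) z ->
  (bounded_combinations (@S n) (c * b n) (unzip1 z) ->
   bounded_combinations (@S n) ((c + 1) * b n) (map D (unzip2 z))) /\
  (bounded_combinations (@S n) (c * b n) (map D (unzip2 z)) ->
   bounded_combinations (@S n) ((c + 1) * b n) (unzip1 z)).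
Proof.
move=> n0 zn zc.
have rel (i : 'I_n) : rnorm (val (unzip1 z)`_i - (map D (unzip2 z))`_i) <= n%:R^-1.
  have iz : (i < size z)%N by rewrite zn.
  rewrite (nth_map (0, 0%N))// (nth_map 0%N) ?size_map// (nth_map (0, 0%N))//.
  by apply/ltW; have /(all_nthP (0, 0%N))/(_ _ iz) := zc.
have valE a : rnorm (\sum_(i < n) a i *: (unzip1 z)`_i) =
    rnorm (\sum_(i < n) a i *: val (unzip1 z)`_i).
  rewrite -[LHS]/(rnorm (val _)); congr (rnorm _).
  by rewrite raddf_sum; exact: eq_bigr.
split=> H a Sa; (apply: (@le_trans _ _ (c * b n + 1));
  last by rewrite mulrDl mul1r lerD2l b_ge1).
- have := H a Sa; rewrite valE => Ha; apply: le_trans (lerD Ha (lexx 1)).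
  apply: rnorm_combination_perturb; first exact: S_le1.
  by move=> i; rewrite -rnormN opprB.
- rewrite valE; apply: le_trans (lerD (H a Sa) (lexx 1)).
  by apply: rnorm_combination_perturb; first exact: S_le1.
Qed.

(** The set is unchanged when the game is replaced by the game with indices: the
constant c is quantified over the natural numbers, and the passage between the
games costs 1. *)
Lemma borel_combination_game : subspace_borel [set F : closed_subspace V |
  exists c : nat, forall n, (0 < n)%N -> exists chi : seq (carrier F) -> set (carrier F),
    winning_strategy (fun x : n.-tuple (carrier F) =>
      bounded_combinations (@S n) (c%:R * b n) x) chi].
Proof.
have : subspace_borel [set F : closed_subspace V | exists c : nat, forall n, (0 < n)%N ->
    D_wins D F (bounded_combinations (@S n) (c%:R * b n)) n [::]].
  apply: borel_exists => c; apply: borel_forall => n; apply: borel_imply => _.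
  exact: borel_D_wins.
apply: borel_equiv => F; split=> -[c cn]; exists c.+1 => n n0;
  have n_gt0 : 0 < n%:R^-1 :> R by rewrite invr_gt0 ltr0n.
- apply/winning_strategyP; rewrite -natr1.
  apply: (@I_wins_of_D_wins _ _ _ D F (bounded_combinations (@S n) (c%:R * b n)) _ n
    n%:R^-1 Ddense n_gt0 _ n [::]) => // [z zn zc|]; last exact: cn.
  by have [] := close_combinations c%:R n0 zn zc.
- have /winning_strategyP Iw := cn n n0; rewrite -natr1.
  apply: (@D_wins_of_I_wins _ _ _ D F (bounded_combinations (@S n) (c%:R * b n)) _ n
    n%:R^-1 n_gt0 _ n [::]) => // z zn zc.
  by have [] := close_combinations c%:R n0 zn zc.
Qed.

End CombinationGames.

(** * The two classes of spaces *)

(** P n c stands for a win of Player I with constant c; being monotone in c, it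
holds for every c above the infimum. *)
Lemma sup_inf_lty (R : realType) (P : nat -> R -> Prop) :
  (forall n c c', c <= c' -> P n c -> P n c') ->
  (ereal_sup [set ereal_inf [set c%:E | c in [set c : R | (0 < c)%R /\ P n c]]
     | n in [set n | (0 < n)%N]] < +oo)%E <->
  exists c : nat, forall n, (0 < n)%N -> P n c%:R.
Proof.
move=> Pmono; split=> [sup_lty|[c cP]].
  have [M supM] : exists M : R, (ereal_sup [set ereal_inf [set c%:E | c in
      [set c : R | (0 < c)%R /\ P n c]] | n in [set n | (0 < n)%N]] < M%:E)%E.
    move: sup_lty; case: ereal_sup => [r _|//|_]; last by exists 0; exact: ltNyr.
    by exists (r + 1); rewrite lte_fin ltrDl.
  exists (Num.truncn M).+1 => n n0.
  have : (ereal_inf [set c%:E | c in [set c : R | (0 < c)%R /\ P n c]] < M%:E)%E.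
    by apply: le_lt_trans supM; apply: ereal_sup_ubound; exists n.
  move=> /ereal_inf_lt[_ [c [_ Pc] <-]]; rewrite lte_fin => cM.
  by apply: Pmono Pc; exact: le_trans (ltW cM) (ltW (truncnS_gt _)).
apply: (@le_lt_trans _ _ (c.+1%:R)%:E); last exact: ltry.
apply: ge_ereal_sup => _ [n n0 <-]; apply: ereal_inf_lbound; exists c.+1%:R => //.
split; first by rewrite ltr0n.
by apply: Pmono (cP n n0); rewrite ler_nat.
Qed.

Lemma winning_strategy_sub (R : realType) k (X : completeNormedModType (scalar_field R k))
    n (win win' : set (n.-tuple X)) chi :
  win `<=` win' -> winning_strategy win chi -> winning_strategy win' chi.
Proof. by move=> ww' [? chiw]; split=> // x xB xchi; exact/ww'/chiw. Qed.

Lemma gt1_powR (R : realType) (a r : R) : 1 < a -> 0 < r -> 1 < a `^ r.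
Proof.
move=> a1 r0; have := @gt0_ltr_powR R r r0 1 a; rewrite powR1; apply=> //.
  by rewrite nnegrE.
by rewrite nnegrE; apply: ltW; exact: lt_trans a1.
Qed.

Section Classes.
Variables (R : realType) (k : scalar_kind) (p : \bar R).
Local Notation K := (scalar_field R k).
Hypothesis hp : (1 < p)%E.

Definition lp_ball (n : nat) : set ('I_n -> K) := [set a | lp_norm p a <= 1].

Lemma lp_ball_le1 n (a : 'I_n -> K) : lp_ball a -> forall i, rnorm (a i : K^o) <= 1.
Proof.
rewrite /lp_ball /= /lp_norm => + i; case: p hp => [r r1|_|//]; last first.
  by apply: le_trans; exact: le_bigmax.
rewrite lte_fin in r1; have r0 : 0 < r by exact: lt_trans r1.
rewrite leNgt => H; rewrite leNgt; apply: contra H => ai1.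
apply: gt1_powR; last by rewrite invr_gt0.
rewrite (bigD1 i)//= ltr_wpDr//; last exact: gt1_powR.
by apply: sumr_ge0 => j _; exact: powR_ge0.
Qed.

Lemma root_ge1 n : (0 < n)%N -> 1 <= n%:R `^ fine p^-1.
Proof.
move=> n0; have n1 : 1 <= n%:R :> R by rewrite ler1n.
suff /(ler_powR n1) : 0 <= fine p^-1 by rewrite powRr0.
case: p hp => [r r1|_|//]; last by rewrite invey.
by rewrite lte_fin in r1; rewrite fine_invr invr_ge0 ltW// (lt_trans _ r1).
Qed.

Lemma class_A_combination (X : completeNormedModType K) : class_A X p <->
  exists c : nat, forall n, (0 < n)%N -> exists chi : seq X -> set X,
    winning_strategy (fun x : n.-tuple X =>
      bounded_combinations (@lp_ball n) (c%:R * 1) x) chi.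
Proof.
have winE c n : A_win c p (n := n) =
    (fun x : n.-tuple X => bounded_combinations (@lp_ball n) (c * 1) x).
  rewrite mulr1; apply/funext => x; apply/propext.
  have sE (a : 'I_n -> K) : \sum_(i < n) a i *: tnth x i = \sum_(i < n) a i *: x`_i.
    by apply: eq_bigr => i _; rewrite (tnth_nth 0).
  by split=> xw a /xw; rewrite sE.
have := @sup_inf_lty R (fun n c => exists chi, winning_strategy (A_win (X := X) c p (n := n)) chi).
rewrite /class_A /a_const /a_const_n => ->.
  by split=> -[c cP]; exists c => n n0; have [chi chiw] := cP n n0;
    exists chi; move: chiw; rewrite winE.
move=> n c c' cc' [chi chiw]; exists chi; apply: winning_strategy_sub chiw.
by move=> x xw a Sa; exact: le_trans (xw a Sa) cc'.
Qed.

Definition all_ones (n : nat) : set ('I_n -> K) := [set (fun=> 1)].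

Lemma class_N_combination (X : completeNormedModType K) : class_N X p <->
  exists c : nat, forall n, (0 < n)%N -> exists chi : seq X -> set X,
    winning_strategy (fun x : n.-tuple X =>
      bounded_combinations (@all_ones n) (c%:R * n%:R `^ fine p^-1) x) chi.
Proof.
have winE c n : N_win c p (n := n) = (fun x : n.-tuple X =>
    bounded_combinations (@all_ones n) (c * n%:R `^ fine p^-1) x).
  apply/funext => x; apply/propext; rewrite /N_win /=.
  have sE : \sum_(i < n) tnth x i = \sum_(i < n) (1 : K) *: x`_i.
    by apply: eq_bigr => i _; rewrite scale1r (tnth_nth 0).
  by rewrite sE; split=> [h _ ->|/(_ _ erefl)].
have := @sup_inf_lty R (fun n c => exists chi, winning_strategy (N_win (X := X) c p (n := n)) chi).
rewrite /class_N /n_const /n_const_n => ->.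
  by split=> -[c cP]; exists c => n n0; have [chi chiw] := cP n n0;
    exists chi; move: chiw; rewrite winE.
move=> n c c' cc' [chi chiw]; exists chi; apply: winning_strategy_sub chiw.
by move=> x xw; apply: le_trans xw _; rewrite ler_wpM2r// powR_ge0.
Qed.

End Classes.

Theorem theorem1 (R : realType) (k : scalar_kind) (p : \bar R) (hp : (1 < p)%E) :
  SB_borel [set F : SB R k | class_A (carrier F) p] /\
  SB_borel [set F : SB R k | class_N (carrier F) p].
Proof.
have dense := @rational_steps_dense R k.
split.
- have := borel_combination_game dense (lp_ball_le1 hp) (fun _ _ => lexx 1).
  by apply: borel_equiv => F; rewrite class_A_combination.
- have := borel_combination_game (S := @all_ones R k) dense _ (root_ge1 hp).
  move=> H; apply: borel_equiv (H _) => [F|n a -> i].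
    by rewrite class_N_combination.
  by rewrite -(of_real1 R k) rnorm_of_real normr1.
Qed.
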